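(* The broad scan test, i.e. the test that rejects for large values of $W_n^\ddag$, is asymptotically powerful if $$\limsup \alpha \leq 1 \quad\text{and}\quad \liminf\ (1-\alpha)\sup_{k=n/u_N}^{n} \frac{\mathbb{E}_S[W_{k,S}^*]}{k} > 1 ;$$ or $$\alpha\to 0 \quad\text{and}\quad \liminf \lambda_1>1 .$$
   Context: Setting. We observe an undirected simple graph $\mathcal{G}$ on the node set $\mathcal{V}=\{1,\dots,N\}$ with adjacency matrix $(W_{i,j})$ (symmetric, $0/1$, zero diagonal). Under the null hypothesis, with distribution $\mathbb{P}_0$, $\mathcal{G}$ is an Erdős–Rényi graph $\mathbb{G}(N,p_0)$, i.e. the $W_{i,j}$, $i<j$, are i.i.d. Bernoulli($p_0$). For $S\subset\mathcal{V}$ with $|S|=n$, under $\mathbb{P}_S$ (expectation $\mathbb{E}_S$) the $W_{i,j}$, $i<j$, are independent with $\mathbb{P}_S(W_{i,j}=1)=p_1$ if $i,j\in S$ and $=p_0$ otherwise, where $p_1>p_0$. The alternative is the union over all $S$ with $|S|=n$. The parameters $n,p_0,p_1$ may depend on $N$; all limits are as $N\to\infty$, with $n\to\infty$, $n/N\to0$, $n/\log N\to\infty$, $N^2p_0\to\infty$, $n^2p_1\to\infty$. Notation. $\lambda_0=Np_0$, $\lambda_1=np_1$, $\alpha=\log\lambda_0/\log(N/n)$, $u_N=\log\log(N/n)$. For $T\subset\mathcal{V}$, $W_T=\sum_{i,j\in T,\,i<j}W_{i,j}$; $W_k^*=\max_{|T|=k}W_T$; for $S\subset\mathcal{V}$,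 $W_{k,S}^*=\max_{T\subset S,\,|T|=k}W_T$. The broad scan statistic is $W_n^\ddag=\sup_{k=n/u_N}^{n} W_k^*/k$, where $\sup_{k=n/u_N}^n$ means the supremum over integers $k$ with $n/u_N\le k\le n$. The quantity $\mathbb{E}_S[W_{k,S}^*]$ with $|S|=n$ does not depend on the choice of $S$. Tests. A test $\phi$ is a $\{0,1\}$-valued function of the adjacency matrix; its risk is $\gamma_N(\phi)=\mathbb{P}_0(\phi=1)+\max_{|S|=n}\mathbb{P}_S(\phi=0)$. The test that rejects for large values of a statistic $T$ is asymptotically powerful if there are critical values $t=t(N)$ (possibly depending on $p_1$) such that the risk of the test $\{T\ge t\}$ tends to $0$. *)

(* Defs.v *)
From HB Require Import structures.
From mathcomp Require Import all_boot all_order all_algebra.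
From mathcomp Require Import all_classical all_reals all_analysis.

Set Implicit Arguments.
Unset Strict Implicit.
Unset Printing Implicit Defensive.

Import Order.TTheory GRing.Theory Num.Theory.
Import numFieldNormedType.Exports.

Local Open Scope ring_scope.
Local Open Scope classical_set_scope.

Definition simple_graph N (W : 'M[bool]_N) : bool :=
  (W == W^T) && [forall i, ~~ W i i].

Section GraphLaw.
Variables (R : realType) (N : nat).

(* Mass at the simple graph W when the edges {i, j} are independent and {i, j}
   is present with probability q i j; only the values at i < j are used. *)
Definition graph_mass (q : 'I_N -> 'I_N -> R) (W : 'M[bool]_N) : R :=
  \prod_(i < N) \prod_(j < N | (i < j)%N) (if W i j then q i j else 1 - q i j).

Definition graph_prob (q : 'I_N -> 'I_N -> R) (A : pred 'M[bool]_N) : R :=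
  \sum_(W : 'M[bool]_N | simple_graph W && A W) graph_mass q W.

Definition graph_expect (q : 'I_N -> 'I_N -> R) (X : 'M[bool]_N -> R) : R :=
  \sum_(W : 'M[bool]_N | simple_graph W) graph_mass q W * X W.

Definition null_edge (p0 : R) (i j : 'I_N) : R := p0.

Definition planted_edge (p0 p1 : R) (S : {set 'I_N}) (i j : 'I_N) : R :=
  if (i \in S) && (j \in S) then p1 else p0.

(* Here and below, a maximum of nonnegative reals over a finite range is
   written with default value 0, which is returned when the range is empty. *)
Definition risk (n : nat) (p0 p1 : R) (phi : 'M[bool]_N -> bool) : R :=
  graph_prob (null_edge p0) phi +
  \big[Num.max/0]_(S : {set 'I_N} | #|S| == n)
     graph_prob (planted_edge p0 p1 S) (fun W => ~~ phi W).

End GraphLaw.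

Definition nedges N (W : 'M[bool]_N) (T : {set 'I_N}) : nat :=
  (\sum_(i in T) \sum_(j in T | i < j) W i j)%N.

Definition max_nedges_in N (W : 'M[bool]_N) (S : {set 'I_N}) (k : nat) : nat :=
  (\max_(T : {set 'I_N} | (T \subset S) && (#|T| == k)) nedges W T)%N.

Definition max_nedges N (W : 'M[bool]_N) (k : nat) : nat :=
  (\max_(T : {set 'I_N} | #|T| == k) nedges W T)%N.

Section BroadScan.
Variable R : realType.

Definition alpha (N n : nat) (p0 : R) : R :=
  ln (N%:R * p0) / ln (N%:R / n%:R).

Definition loglog_ratio (N n : nat) : R := ln (ln (N%:R / n%:R)).

(* The range n / u_N <= k <= n is nonempty, and excludes k = 0, as soon as
   u_N >= 1 and n > 0. *)
Definition scan_sup (N n : nat) (f : nat -> R) : R :=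
  \big[Num.max/0]_(k < n.+1 | n%:R / loglog_ratio N n <= k%:R) f k.

Definition broad_scan N (n : nat) (W : 'M[bool]_N) : R :=
  scan_sup N n (fun k => (max_nedges W k)%:R / k%:R).

Definition planted_scan N (p0 p1 : R) (S : {set 'I_N}) : R :=
  scan_sup N #|S| (fun k =>
    graph_expect (planted_edge p0 p1 S) (fun W => (max_nedges_in W S k)%:R)
      / k%:R).

Definition asymptotically_powerful (n : nat -> nat) (p0 p1 : nat -> R)
    (T : forall N, 'M[bool]_N -> R) : Prop :=
  exists t : nat -> R,
    (fun N => risk (n N) (p0 N) (p1 N) (fun W : 'M[bool]_N => t N <= T N W))
      @ \oo --> (0 : R).

End BroadScan.

(* Main.v *)
Require Import Defs.
From HB Require Import structures.
From mathcomp Require Import all_boot all_order all_algebra.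
From mathcomp Require Import all_classical all_reals all_analysis.
From mathcomp Require Import perm fintype finset zify ring lra.

Set Implicit Arguments.
Unset Strict Implicit.
Unset Printing Implicit Defensive.

Import Order.TTheory GRing.Theory Num.Theory.
Import numFieldNormedType.Exports.

Local Open Scope ring_scope.

(* Let f_k be the maximal number of edges spanned by k vertices of the planted
   set S, l = log(N/n), and reject when the scan exceeds (1 + eps/2)/(1 - alpha).
   - Under the null, a union bound over the sets of size k and Chernoff's bound
     with exponential parameter (1 - alpha) l = - log(n p0) make the probability
     of rejection O(1/l).
   - Under the alternative, f_k is self-bounding, so Var f_k <= E f_k by
     Efron-Stein, and Chebyshev's inequality shows that the scan exceeds
     (1 - d) E f_k / k for any fixed d > 0, for each k with E f_k -> oo.
   - When n p1 >= 1 + 3 g, thin the planted graph to density (1 + 2 g)/n.  The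
     exploration of the cluster of a vertex, stopped once it has found
     k ~ delta n vertices, survives with probability bounded below
     (supermartingale theta^(number of active vertices)); hence E f_k is at
     least k - o(k) by the same concentration.  The remaining density g/n adds
     about g k^2/(2 n) edges inside a maximizing set, whence E f_k >= (1 + e) k
     for a fixed e > 0. *)

(** * Product Bernoulli expectations *)

Definition upd (E : eqType) (x : E -> bool) (e : E) (b : bool) : E -> bool :=
  fun e' => if e' == e then b else x e'.

Lemma upd_same (E : eqType) (x : E -> bool) e b : upd x e b e = b.
Proof. by rewrite /upd eqxx. Qed.

Lemma upd_other (E : eqType) (x : E -> bool) e b e' :
  e' != e -> upd x e b e' = x e'.
Proof. by rewrite /upd => /negbTE ->. Qed.

Lemma upd_comm (E : eqType) (x : E -> bool) e b e' b' : e != e' ->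
  upd (upd x e b) e' b' = upd (upd x e' b') e b.
Proof.
move=> ne; apply/funext => a; rewrite /upd.
by case: (eqVneq a e') (eqVneq a e) => [->|_] [h|_] //; rewrite h eqxx in ne.
Qed.

Section Bernoulli.
Variables (R : realFieldType) (E : eqType).
Implicit Types (q : E -> R) (s : seq E) (f g : (E -> bool) -> R).
Implicit Types (x y : E -> bool) (e : E).

(* Expectation of [f] when the coordinates listed in [s] are resampled as
   independent Bernoulli([q e]) and the other ones are frozen at their value
   in [x]. *)
Fixpoint Ex q s f x : R :=
  if s is e :: s' then
    q e * Ex q s' f (upd x e true) + (1 - q e) * Ex q s' f (upd x e false)
  else f x.

Definition is_proba q := forall e, 0 <= q e <= 1.

Lemma ExD q s f g x : Ex q s (fun y => f y + g y) x = Ex q s f x + Ex q s g x.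
Proof. by elim: s x => //= e s IH x; rewrite !IH; ring. Qed.

Lemma ExZ q s a f x : Ex q s (fun y => a * f y) x = a * Ex q s f x.
Proof. by elim: s x => //= e s IH x; rewrite !IH; ring. Qed.

Lemma ExB q s f g x : Ex q s (fun y => f y - g y) x = Ex q s f x - Ex q s g x.
Proof. by elim: s x => //= e s IH x; rewrite !IH; ring. Qed.

Lemma Ex_cst q s a x : Ex q s (fun=> a) x = a.
Proof. by elim: s x => //= e s IH x; rewrite !IH; ring. Qed.

Lemma Ex_sum (I : Type) (r : seq I) (P : pred I) q s (F : I -> (E -> bool) -> R) x :
  Ex q s (fun y => \sum_(i <- r | P i) F i y) x =
  \sum_(i <- r | P i) Ex q s (F i) x.
Proof.
elim: r => [|i r IH].
  by under eq_fun do rewrite big_nil; rewrite Ex_cst big_nil.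
rewrite big_cons -IH; case: ifP => Pi; last first.
  by congr (Ex _ _ _ _); apply/funext => y; rewrite big_cons Pi.
by rewrite -ExD; congr (Ex _ _ _ _); apply/funext => y; rewrite big_cons Pi.
Qed.

(** Coordinates outside [s] keep their values in [x], so only such points have to be compared. The
    exploration uses this to remember the edges already revealed. *)
Lemma Ex_le_on q s f g x : is_proba q ->
  (forall y, (forall e, e \notin s -> y e = x e) -> f y <= g y) ->
  Ex q s f x <= Ex q s g x.
Proof.
move=> q01; elim: s x => [|e s IH] x /= fg; first exact: fg.
have /andP[q0 q1] := q01 e.
apply: lerD; apply: ler_wpM2l; rewrite ?subr_ge0 //; apply: IH => y yx;
  apply: fg => e'; rewrite inE negb_or => /andP[ne es];
  by rewrite yx // upd_other.
Qed.

Lemma Ex_le q s f g x : is_proba q -> (forall y, f y <= g y) ->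
  Ex q s f x <= Ex q s g x.
Proof. by move=> q01 fg; apply: Ex_le_on. Qed.

Lemma Ex_ge0 q s f x : is_proba q -> (forall y, 0 <= f y) -> 0 <= Ex q s f x.
Proof. by move=> q01 f0; rewrite -[leLHS](Ex_cst q s 0 x); apply: Ex_le. Qed.

Lemma Ex_upd q s f x e b : e \notin s ->
  Ex q s f (upd x e b) = Ex q s (fun y => f (upd y e b)) x.
Proof.
elim: s x => //= a s IH x; rewrite inE negb_or => /andP[ne es].
by rewrite !(upd_comm _ _ _ ne) !IH.
Qed.

(** The order of resampling is irrelevant, so an exploration may reveal the coordinates in an order
    that depends on what it has seen. *)
Lemma Ex_rem q s f x e : e \in s ->
  Ex q s f x = q e * Ex q (rem e s) f (upd x e true)
             + (1 - q e) * Ex q (rem e s) f (upd x e false).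
Proof.
elim: s x => //= a s IH x; rewrite inE; case: (eqVneq e a) => [-> //|ne] /= es.
rewrite eq_sym in ne.
by rewrite !IH // !(upd_comm x _ _ ne); ring.
Qed.

Lemma Ex_coord q s (h : bool -> R) x e : e \in s -> uniq s ->
  Ex q s (fun y => h (y e)) x = q e * h true + (1 - q e) * h false.
Proof.
move=> es us; rewrite (Ex_rem _ _ _ es).
have er : e \notin rem e s by rewrite mem_rem_uniq // !inE eqxx.
rewrite !Ex_upd //.
by congr (_ * _ + _ * _); under eq_fun do rewrite upd_same; rewrite Ex_cst.
Qed.

Lemma Ex_prod q s (h : E -> bool -> R) x : uniq s ->
  Ex q s (fun y => \prod_(e <- s) h e (y e)) x =
  \prod_(e <- s) (q e * h e true + (1 - q e) * h e false).
Proof.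
elim: s x => [|e s IH] x /=; first by rewrite !big_nil.
move=> /andP[es us]; rewrite big_cons [RHS]mulrDl.
rewrite -!(IH x) // -!mulrA -!ExZ.
rewrite !Ex_upd //.
congr (Ex _ _ _ _ + Ex _ _ _ _); apply/funext => y;
  rewrite big_cons upd_same; congr (_ * (_ * _));
  by apply: eq_big_seq => a as_; rewrite upd_other //; apply: contraNneq es => <-.
Qed.

(** * Variance, Chebyshev bounds and sprinkling *)

Lemma Ex_jensen q s f x : is_proba q ->
  (Ex q s f x) ^+ 2 <= Ex q s (fun y => f y ^+ 2) x.
Proof.
move=> q01; set m := Ex q s f x.
have : 0 <= Ex q s (fun y => (f y - m) ^+ 2) x.
  by apply: Ex_ge0 => // y; exact: sqr_ge0.
rewrite (_ : (fun y => _) = (fun y => f y ^+ 2 - (2 * m) * f y + m ^+ 2)); last first.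
  by apply/funext => y; ring.
by rewrite ExD ExB ExZ Ex_cst -/m; nra.
Qed.

(* Only the drop of [f] when a coordinate is erased matters: it bounds the
   variance of [f] along that coordinate. *)
Lemma Efron_Stein q s f x : is_proba q -> uniq s ->
  Ex q s (fun y => f y ^+ 2) x - (Ex q s f x) ^+ 2 <=
  Ex q s (fun y => \sum_(e <- s) (f y - f (upd y e false)) ^+ 2) x.
Proof.
move=> q01; elim: s x => [|e s IH] x /=.
  by rewrite big_nil subrr.
move=> /andP[es us]; have /andP[q0 q1] := q01 e.
have h b : Ex q s (fun y => f y ^+ 2) (upd x e b) - (Ex q s f (upd x e b)) ^+ 2
    + Ex q s (fun y => (f y - f (upd y e false)) ^+ 2) (upd x e b) <=
  Ex q s (fun y => \sum_(a <- e :: s) (f y - f (upd y a false)) ^+ 2) (upd x e b).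
  under [X in _ <= Ex _ _ X _]eq_fun do rewrite big_cons.
  by rewrite ExD addrC lerD2l; exact: IH.
have ff y b : upd (upd y e b) e false = upd y e false.
  by apply/funext => a; rewrite /upd; case: eqP.
have j : (Ex q s f (upd x e true) - Ex q s f (upd x e false)) ^+ 2 <=
   Ex q s (fun y => (f y - f (upd y e false)) ^+ 2) (upd x e true).
  have -> : Ex q s f (upd x e false) =
            Ex q s (fun y => f (upd y e false)) (upd x e true).
    by rewrite !Ex_upd //; under [in RHS]eq_fun do rewrite ff.
  by rewrite -ExB; exact: Ex_jensen.
have j0 : 0 <= Ex q s (fun y => (f y - f (upd y e false)) ^+ 2) (upd x e false).
  by apply: Ex_ge0 => // y; exact: sqr_ge0.
(* The variance is the mean of the conditional variances plus [p * (1 - p) * (m1 - m0) ^+ 2]. As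
   [p * (1 - p) <= p], the last term is paid by the outcomes where the coordinate is present. *)
have alg (p F1 F0 m1 m0 G1 G0 H1 H0 : R) : 0 <= p -> p <= 1 ->
    (m1 - m0) ^+ 2 <= G1 -> 0 <= G0 -> F1 - m1 ^+ 2 + G1 <= H1 ->
    F0 - m0 ^+ 2 + G0 <= H0 ->
    p * F1 + (1 - p) * F0 - (p * m1 + (1 - p) * m0) ^+ 2 <=
    p * H1 + (1 - p) * H0.
  move=> {}q0 {}q1 {}j {}j0 ht hf.
  have -> : p * F1 + (1 - p) * F0 - (p * m1 + (1 - p) * m0) ^+ 2 =
    p * (F1 - m1 ^+ 2) + (1 - p) * (F0 - m0 ^+ 2)
    + p * (1 - p) * (m1 - m0) ^+ 2 by ring.
  have a1 : p * (F1 - m1 ^+ 2 + G1) <= p * H1 by apply: ler_wpM2l.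
  have a0 : (1 - p) * (F0 - m0 ^+ 2 + G0) <= (1 - p) * H0.
    by apply: ler_wpM2l; rewrite ?subr_ge0.
  have b1 : p * (m1 - m0) ^+ 2 <= p * G1 by apply: ler_wpM2l.
  have b0 : 0 <= (1 - p) * G0 by rewrite mulr_ge0 ?subr_ge0.
  have c : p * (1 - p) * (m1 - m0) ^+ 2 <= p * (m1 - m0) ^+ 2.
    by rewrite -mulrA; apply: ler_wpM2l => //; rewrite ler_piMl ?sqr_ge0 //; lra.
  lra.
exact: alg q0 q1 j j0 (h true) (h false).
Qed.

Lemma chebyshev_lower q s f x (d : R) : is_proba q -> 0 < d ->
  Ex q s (fun y => (f y <= Ex q s f x - d)%R%:R) x * d ^+ 2 <=
  Ex q s (fun y => f y ^+ 2) x - (Ex q s f x) ^+ 2.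
Proof.
move=> q01 d0; set m := Ex q s f x.
have -> : Ex q s (fun y => f y ^+ 2) x - m ^+ 2 = Ex q s (fun y => (f y - m) ^+ 2) x.
  rewrite [in RHS](_ : (fun y => _) = (fun y => f y ^+ 2 - (2 * m) * f y + m ^+ 2)); last first.
    by apply/funext => y; ring.
  by rewrite ExD ExB ExZ Ex_cst -/m; ring.
rewrite mulrC -ExZ; apply: Ex_le => // y.
by case: (lerP (f y) (m - d)) => h; rewrite ?mulr1 ?mulr0 ?sqr_ge0 //; nra.
Qed.

Lemma chebyshev_upper q s f x (d : R) : is_proba q -> 0 < d ->
  Ex q s (fun y => (Ex q s f x + d <= f y)%R%:R) x * d ^+ 2 <=
  Ex q s (fun y => f y ^+ 2) x - (Ex q s f x) ^+ 2.
Proof.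
move=> q01 d0; have := @chebyshev_lower q s (fun y => -1 * f y) x d q01 d0.
rewrite ExZ; under [X in _ <= Ex _ _ X _ - _]eq_fun do rewrite exprMn sqrrN expr1n mul1r.
rewrite exprMn sqrrN expr1n mul1r; congr (Ex _ _ _ _ * _ <= _).
by apply/funext => y; congr (_%:R); congr nat_of_bool; apply/idP/idP; lra.
Qed.

Lemma Ex_sprinkle q q1 q2 s f x z :
  (forall e, 1 - q e = (1 - q1 e) * (1 - q2 e)) ->
  Ex q s f (fun e => x e || z e) =
  Ex q1 s (fun y => Ex q2 s (fun w => f (fun e => y e || w e)) z) x.
Proof.
move=> qq; elim: s x z => //= e s IH x z.
rewrite !ExD !ExZ -!IH.
have u b b' : (fun e' => upd x e b e' || upd z e b' e') =
              upd (fun e' => x e' || z e') e (b || b').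
  by apply/funext => a; rewrite /upd; case: eqP.
rewrite !u /=; have -> : q e = 1 - (1 - q1 e) * (1 - q2 e) by rewrite -qq; ring.
ring.
Qed.

End Bernoulli.

(** * Random graphs as families of independent edges *)

(** An outcome is encoded as the set of its true coordinates; this links the recursive expectation
    to the sum over graphs. *)
Lemma Ex_setE (R : realFieldType) (E : finType) (q : E -> R) s f x : uniq s ->
  Ex q s f x = \sum_(D : {set E} | D \subset s)
     (\prod_(e <- s) if e \in D then q e else 1 - q e)
       * f (fun e => if e \in s then e \in D else x e).
Proof.
elim: s x => [|e s IH] x /=.
  move=> _; rewrite (big_pred1 set0) => [|D]; first by rewrite big_nil mul1r.
  apply/idP/eqP => [Ds|->]; last by apply/subsetP => a; rewrite inE.
  by apply/eqP; rewrite -finset.subset0; apply/subsetP => a /(subsetP Ds).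
move=> /andP[es us]; rewrite !IH // [RHS](bigID (fun D : {set E} => e \in D)) /=.
have ss (D : {set E}) : D \subset s -> e \notin D.
  by move=> /subsetP Ds; apply: contra es => /Ds.
rewrite !big_distrr /=; congr (_ + _).
  rewrite [RHS](reindex_onto (fun D : {set E} => e |: D) (fun D => D :\ e)) /=; last first.
    by move=> D /andP[_ eD]; rewrite setD1K.
  apply: eq_big => [D|D Ds].
    rewrite setU11 andbT; apply/idP/andP => [Ds|[/subsetP eDs /eqP De]].
      split; last by rewrite setU1K // ss.
      by apply/subsetP => a; rewrite !inE => /orP[-> //|/(subsetP Ds) ->]; rewrite orbT.
    have eD : e \notin D by rewrite -De !inE eqxx.
    apply/subsetP => a aD; have := eDs a; rewrite !inE aD orbT => /(_ isT) /orP[/eqP ae|//].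
    by rewrite -ae aD in eD.
  rewrite big_cons setU11 mulrA; congr (_ * _ * f _).
    apply: eq_big_seq => a as_; rewrite !inE; case: (eqVneq a e) => //= ae.
    by rewrite -ae as_ in es.
  apply/funext => a; rewrite !inE /upd; case: (eqVneq a e) => [->|] //=.
  by rewrite (negbTE es).
apply: eq_big => [D|D Ds].
  apply/idP/andP => [Ds|[/subsetP eDs eD]].
    split; last exact: ss.
    by apply/subsetP => a /(subsetP Ds); rewrite inE => ->; rewrite orbT.
  apply/subsetP => a aD; have := eDs a aD; rewrite !inE => /orP[/eqP ae|//].
  by rewrite -ae aD in eD.
rewrite big_cons (negbTE (ss _ Ds)) mulrA; congr (_ * _ * f _).
apply/funext => a; rewrite !inE /upd; case: (eqVneq a e) => [->|] //=.
by rewrite (negbTE es) (negbTE (ss _ Ds)).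
Qed.

Definition edges N : seq ('I_N * 'I_N) :=
  [seq e : 'I_N * 'I_N <- enum {: 'I_N * 'I_N} | (e.1 < e.2)%N].

Lemma mem_edges N e : (e \in edges N) = (e.1 < e.2)%N.
Proof. by rewrite mem_filter mem_enum andbT. Qed.

Lemma edges_uniq N : uniq (edges N).
Proof. by rewrite filter_uniq ?enum_uniq. Qed.

Lemma big_edges (T : Type) (idx : T) (op : Monoid.com_law idx) N
    (P : pred ('I_N * 'I_N)) F :
  \big[op/idx]_(e <- edges N | P e) F e =
  \big[op/idx]_(e : 'I_N * 'I_N | (e.1 < e.2)%N && P e) F e.
Proof. by rewrite big_filter_cond big_enum_cond. Qed.

Definition graph_of N (y : 'I_N * 'I_N -> bool) : 'M[bool]_N :=
  \matrix_(i, j) ((i < j)%N && y (i, j) || (j < i)%N && y (j, i)).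

Lemma graph_ofE N (y : 'I_N * 'I_N -> bool) (i j : 'I_N) : (i < j)%N ->
  graph_of y i j = y (i, j).
Proof. by move=> ij; rewrite mxE ij /= ltnNge ltnW //= orbF. Qed.

(** Simple graphs are in bijection with the subsets of [edges N]; the side condition of the
    reindexing discards all other sets of pairs. *)
Lemma graph_expectE (R : realType) N (q : 'I_N -> 'I_N -> R) X :
  graph_expect q X =
  Ex (fun e => q e.1 e.2) (edges N) (fun y => X (graph_of y)) (fun=> false).
Proof.
rewrite Ex_setE ?edges_uniq // /graph_expect.
rewrite (reindex_onto (fun D : {set 'I_N * 'I_N} => graph_of (fun e => e \in D))
   (fun W => [set e : 'I_N * 'I_N | (e.1 < e.2)%N && W e.1 e.2])) /=; last first.
  move=> W /andP[/eqP Wsym /forallP W0]; apply/matrixP => i j; rewrite mxE !inE /=.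
  rewrite andbA andbb andbA andbb.
  case: (ltngtP i j) => /= [_|_|ij]; first by rewrite orbF.
    by rewrite {1}Wsym mxE.
  by rewrite (ord_inj ij) (negbTE (W0 j)).
apply: eq_big => [D|D Ds].
  apply/andP/subsetP => [[_ /eqP <-] e|Ds].
    by rewrite inE mem_edges => /andP[].
  split; first apply/andP; first split.
  - by apply/eqP/matrixP => i j; rewrite !mxE orbC.
  - by apply/forallP => i; rewrite mxE ltnn.
  - apply/eqP/setP => -[i j]; rewrite inE /=.
    apply/andP/idP => [[ij]|/[dup] /Ds]; first by rewrite graph_ofE.
    by rewrite mem_edges /= => ij eD; rewrite ij graph_ofE.
congr (_ * X _).
  rewrite /graph_mass pair_big_dep [RHS]big_edges /=.
  by apply: eq_big => [e|[i j] /= ij]; rewrite ?andbT ?graph_ofE.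
apply/matrixP => i j; rewrite !mxE; congr (_ || _).
  by case: ltnP => //= ij; rewrite mem_edges ij.
by case: ltnP => //= ij; rewrite mem_edges ij.
Qed.

Lemma graph_probE (R : realType) N (q : 'I_N -> 'I_N -> R) A :
  graph_prob q A = graph_expect q (fun W => (A W)%:R).
Proof.
rewrite /graph_prob /graph_expect big_mkcondr /=.
by apply: eq_bigr => W _; case: (A W); rewrite ?mulr1 ?mulr0.
Qed.

Definition edge_in N (T : {set 'I_N}) (e : 'I_N * 'I_N) : bool :=
  (e.1 \in T) && (e.2 \in T).

Lemma nedgesE N (W : 'M[bool]_N) T :
  nedges W T = (\sum_(e <- edges N | edge_in T e) W e.1 e.2)%N.
Proof.
rewrite /nedges pair_big_dep /= big_edges; apply: eq_bigl => -[i j] /=.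
by rewrite /edge_in andbA andbC.
Qed.

Lemma nedges_graph_of N (y : 'I_N * 'I_N -> bool) T :
  nedges (graph_of y) T =
  (\sum_(e <- edges N | edge_in T e) y e)%N.
Proof.
rewrite nedgesE big_seq_cond [RHS]big_seq_cond; apply: eq_bigr => -[i j].
by rewrite mem_edges => /andP[ij _]; rewrite graph_ofE.
Qed.

(** Ordered pairs in [T] lie above, below or on the diagonal, and the first two kinds are
    equinumerous. *)
Lemma card_edges_in N (T : {set 'I_N}) :
  (2 * \sum_(e <- edges N | edge_in T e) 1 = #|T| * #|T|.-1)%N.
Proof.
have -> : (\sum_(e <- edges N | edge_in T e) 1 =
           \sum_(i in T) \sum_(j in T | (i < j)%N) 1)%N.
  rewrite big_edges pair_big_dep /=; apply: eq_bigl => e.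
  by rewrite /edge_in andbC andbA.
set m := (\sum_(i in T) _)%N.
  have : (#|T| * #|T| = 2 * m + #|T|)%N.
  have m' : m = (\sum_(i in T) \sum_(j in T | (j < i)%N) 1)%N.
    rewrite /m (exchange_big_dep (fun j => j \in T)) //=.
    - by apply: eq_bigr => i iT; apply: eq_bigl => j; rewrite iT.
    - by move=> i j _ /andP[].
  transitivity (\sum_(i in T) \sum_(j in T) 1)%N.
    by rewrite -sum_nat_const; apply: eq_bigr => i _; rewrite sum1_card.
  transitivity (m + m + \sum_(i in T) 1)%N; last by rewrite sum1_card mul2n addnn.
  rewrite {2}m' -!big_split /=.
  apply: eq_bigr => i iT.
  rewrite (bigID (fun j : 'I_N => (i < j)%N)) /=.
  rewrite [X in (_ + X = _)%N](bigD1 i) /= ?ltnn ?iT //.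
  rewrite -addnA; congr (_ + _)%N; rewrite addnC; congr (_ + _)%N.
  apply: eq_bigl => j; rewrite -leqNgt -andbA; congr (_ && _).
  by rewrite -(inj_eq val_inj) /= andbC ltn_neqAle.
by case: #|T| => [|t] /=; lia.
Qed.

Lemma max_nedges_inP N (W : 'M[bool]_N) (S : {set 'I_N}) k : (k <= #|S|)%N ->
  exists T : {set 'I_N}, [/\ T \subset S, #|T| = k & max_nedges_in W S k = nedges W T].
Proof.
move=> kS.
have [T /andP[TS /eqP Tk] ->] : {T : {set 'I_N} | (T \subset S) && (#|T| == k) &
    max_nedges_in W S k = nedges W T}.
  apply: eq_bigmax_cond; rewrite -[X in (_ < X)%N]/#|[pred T : {set 'I_N} | (T \subset S) && (#|T| == k)]|.
  rewrite (_ : #|_| = #|[set T : {set 'I_N} | T \subset S & #|T| == k]|); last by rewrite cardsE.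
  by rewrite cards_draws bin_gt0.
by exists T.
Qed.

Lemma leq_max_nedges_in N (W : 'M[bool]_N) (S T : {set 'I_N}) :
  T \subset S -> (nedges W T <= max_nedges_in W S #|T|)%N.
Proof. by move=> TS; apply: (leq_bigmax_cond (F := nedges W)); rewrite TS eqxx. Qed.

Lemma leq_max_nedges N (W : 'M[bool]_N) S k :
  (max_nedges_in W S k <= max_nedges W k)%N.
Proof.
apply/bigmax_leqP => T /andP[_ Tk].
exact: (leq_bigmax_cond (F := nedges W)).
Qed.

(** One maximizer [T] serves every [e]: after the erasure [T] still competes, having lost at most
    the edge [e] itself. *)
Lemma max_nedges_in_erase N (y : 'I_N * 'I_N -> bool) (S : {set 'I_N}) k :
  (k <= #|S|)%N -> exists T : {set 'I_N}, [/\ #|T| = k,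
   nedges (graph_of y) T = max_nedges_in (graph_of y) S k &
   forall e, (max_nedges_in (graph_of (upd y e false)) S k <=
              max_nedges_in (graph_of y) S k <=
              max_nedges_in (graph_of (upd y e false)) S k + (edge_in T e && y e))%N].
Proof.
move=> kS; have [T [TS Tk fT]] := max_nedges_inP (graph_of y) kS.
exists T; split => // e; apply/andP; split.
  apply/bigmax_leqP => U /andP[US /eqP Uk].
  apply: leq_trans (_ : nedges (graph_of y) U <= _)%N; last by rewrite -Uk leq_max_nedges_in.
  rewrite !nedges_graph_of; apply: leq_sum => a _.
  by rewrite /upd; case: (eqVneq a e).
rewrite fT; apply: (@leq_trans (nedges (graph_of (upd y e false)) T +
    (edge_in T e && y e))%N); last by rewrite leq_add2r -Tk leq_max_nedges_in.
rewrite !nedges_graph_of; rewrite !big_edges /=.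
have [eT|eT] := boolP ((e.1 < e.2)%N && edge_in T e).
  have /andP[_ ->] := eT.
  rewrite !(bigD1 e eT) /= upd_same add0n addnC leq_add2r.
  by apply: leq_sum => a /andP[_ ae]; rewrite upd_other.
rewrite -[leqLHS]addn0 leq_add //; apply: leq_sum => a aE.
by rewrite upd_other //; apply: contraNneq eT => <-.
Qed.

(** * Mean and variance of the maximal number of edges *)

Section MaxEdges.
Variables (R : realFieldType) (N : nat).
Implicit Types (q : 'I_N * 'I_N -> R) (S : {set 'I_N}).

Definition mean_max q S k : R :=
  Ex q (edges N) (fun y => (max_nedges_in (graph_of y) S k)%:R) (fun=> false).

(* Self-bounding: only the edges of a maximizing [T] can matter, and their
   number is the maximum itself. *)
Lemma var_max_le_mean q S k : is_proba q -> (k <= #|S|)%N ->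
  Ex q (edges N) (fun y => (max_nedges_in (graph_of y) S k)%:R ^+ 2) (fun=> false)
    - mean_max q S k ^+ 2 <= mean_max q S k.
Proof.
move=> q01 kS.
apply: (le_trans (Efron_Stein _ _ q01 (edges_uniq N))); apply: Ex_le => // y.
have [T [Tk fT fe]] := max_nedges_in_erase y kS.
rewrite -[in leRHS]fT nedges_graph_of natr_sum [leRHS]big_mkcond; apply: ler_sum => e _.
have /andP[] := fe e.
move: (max_nedges_in _ _ _) (max_nedges_in _ _ _) => b a ab ba.
have : (b - a <= (edge_in T e && y e))%N by lia.
rewrite -natrB // -natrX.
case: (edge_in T e) => /=; last first.
  by rewrite leqn0 => /eqP ->.
by rewrite ler_nat; case: (y e); case: (b - a)%N => // -[].
Qed.

(** A maximizer [T] for the first graph is independent of the second one, which fills each missing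
    pair of [T] with probability at least [r]. A pair with indicator [y] thus contributes at least
    [(1 - r) * y + r]. *)
Lemma mean_max_sprinkle q q1 q2 S k r :
  is_proba q1 -> is_proba q2 ->
  (forall e, 1 - q e = (1 - q1 e) * (1 - q2 e)) -> (k <= #|S|)%N ->
  (forall e, edge_in S e -> r <= q2 e) ->
  (1 - r) * mean_max q1 S k + r * ((k * k.-1)%:R / 2) <= mean_max q S k.
Proof.
move=> q101 q201 qq kS rq.
rewrite {2}/mean_max (Ex_sprinkle _ _ (fun=> false) (fun=> false) qq).
rewrite -(Ex_cst q1 (edges N) (r * _) (fun=> false)) -ExZ -ExD.
apply: Ex_le => // y.
have [T [TS Tk fT]] := max_nedges_inP (graph_of y) kS.
apply: (@le_trans _ _ (Ex q2 (edges N) (fun w =>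
    (nedges (graph_of (fun e => y e || w e)) T)%:R) (fun=> false))); last first.
  by apply: Ex_le => // w; rewrite ler_nat -Tk leq_max_nedges_in.
under [X in _ <= Ex _ _ X _]eq_fun do rewrite nedges_graph_of natr_sum.
rewrite Ex_sum fT nedges_graph_of.
have -> : (k * k.-1)%:R / 2 = (\sum_(e <- edges N | edge_in T e) 1)%N%:R :> R.
  by rewrite -Tk -card_edges_in natrM mulrC mulKf // pnatr_eq0.
rewrite !natr_sum !mulr_sumr -big_split /= big_seq_cond [leRHS]big_seq_cond.
apply: ler_sum => e /andP[eE /andP[e1 e2]].
rewrite (Ex_coord _ (fun b => (y e || b)%:R)) ?edges_uniq // orbT orbF.
have : r <= q2 e by apply: rq; rewrite /edge_in !(subsetP TS).
by case: (y e) => /=; lra.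
Qed.

End MaxEdges.

(** * Cluster exploration and sprinkling *)

Definition edge N (u v : 'I_N) : 'I_N * 'I_N := if (u < v)%N then (u, v) else (v, u).

Lemma edgeC N (u v : 'I_N) : edge u v = edge v u.
Proof. by rewrite /edge; case: ltngtP => // /ord_inj ->. Qed.

Lemma edge_inj N (u v u' v' : 'I_N) : edge u v = edge u' v' ->
  (u = u' /\ v = v') \/ (u = v' /\ v = u').
Proof. by rewrite /edge; do 2 case: ifP => _; case=> -> ->; auto. Qed.

Lemma edge_lt N (u v : 'I_N) : u != v -> ((edge u v).1 < (edge u v).2)%N.
Proof.
by rewrite /edge neq_ltn; case: ifP => //= ->.
Qed.

Lemma edge_in_edge N (T : {set 'I_N}) u v : u \in T -> v \in T -> edge_in T (edge u v).
Proof. by rewrite /edge_in /edge; case: ifP => _ -> ->. Qed.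

Lemma nedges_mono N (y y' : 'I_N * 'I_N -> bool) (T : {set 'I_N}) :
  (forall e, y e -> y' e) -> (nedges (graph_of y) T <= nedges (graph_of y') T)%N.
Proof.
move=> yy; rewrite !nedges_graph_of; apply: leq_sum => e _.
by case: (y e) (yy e) => // /(_ isT) ->.
Qed.

(** A vertex joining the explored cluster brings the edge that discovered it, so the cluster always
    spans at least as many edges as a tree. *)
Lemma nedges_setU1 N (y : 'I_N * 'I_N -> bool) (X : {set 'I_N}) u v :
  u \notin X -> v \in X -> y (edge v u) ->
  (nedges (graph_of y) X < nedges (graph_of y) (u |: X))%N.
Proof.
move=> uX vX yvu; rewrite !nedges_graph_of !big_edges /=.
have vu : v != u by apply: contraNneq uX => <-.
rewrite [ltnRHS](bigD1 (edge v u)) /=; last first.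
  by rewrite edge_lt // edge_in_edge // !inE ?eqxx // vX orbT.
rewrite yvu add1n ltnS big_mkcond [leqRHS]big_mkcond /=.
apply: leq_sum => e _; case: ifP => // /andP[e12 /andP[e1 e2]].
rewrite e12 /edge_in !inE e1 e2 !orbT /= ifT //.
apply: contraNneq uX => eE; move: e1 e2; rewrite eE /edge.
by case: ifP.
Qed.

Section Exploration.
Variables (R : realFieldType) (N : nat) (q : 'I_N * 'I_N -> R) (S : {set 'I_N}).
Variables (k : nat) (p theta : R).
Hypotheses (q01 : is_proba q) (qp : forall e, edge_in S e -> q e = p).
Hypotheses (p01 : 0 <= p <= 1) (theta01 : 0 <= theta <= 1) (kS : (k <= #|S|)%N).

(* Generating function at [theta] of a single Bernoulli([p]) query. *)
Let r : R := 1 - p * (1 - theta).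

(** As long as at most [k] vertices are explored, a vertex about to be processed faces at least
    [#|S| - k] candidates. Trading its factor [theta] for their factors [r] then does not increase
    the weight. *)
Hypothesis r_theta : r ^+ (#|S| - k) <= theta.

(* [X] is the explored cluster, [A] its vertices that are still to be
   processed, [v] the vertex being processed and [Q] the vertices that [v] has
   not been tested against; [es] lists the unrevealed edges.  Along the
   exploration [theta ^ #|A| * r ^ #|Q|] is a supermartingale that equals 1 when
   the exploration dies out. *)
Lemma exploration_fails m es x (X A Q : {set 'I_N}) v :
  uniq es -> X \subset S -> A \subset X -> v \in X -> v \notin A ->
  Q \subset S :\: X -> (#|X| <= k)%N ->
  (forall u w, u \in A -> w \in S :\: X -> edge u w \in es) ->
  (forall w, w \in Q -> edge v w \in es) ->
  (forall u w, u \in S :\: X -> w \in S :\: X -> u != w -> edge u w \in es) ->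
  (#|X|.-1 <= nedges (graph_of (fun e => (e \notin es) && x e)) X)%N ->
  ((#|A| + #|S :\: X|) * N.+1 + #|Q| < m)%N ->
  Ex q es (fun y => (max_nedges_in (graph_of y) S k < k.-1)%N%:R) x <=
    theta ^+ #|A| * r ^+ #|Q|.
Proof.
have /andP[t0 t1] := theta01; have /andP[p0 p1] := p01.
have r0 : 0 <= r by rewrite /r; nra.
have r1 : r <= 1 by rewrite /r; nra.
elim: m es x X A Q v => // m IH es x X A Q v ues XS AX vX vA QX Xk AU vQ UU eX mm.
have rhs0 a b : 0 <= theta ^+ a * r ^+ b by rewrite mulr_ge0 ?exprn_ge0.
(* With [k] vertices explored, the revealed edges inside [X] already number at least [k - 1], so
   failure is impossible. *)
have [Xk'|Xk'] := eqVneq #|X| k.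
  apply: le_trans (rhs0 _ _); rewrite -[leRHS](Ex_cst q es 0 x).
  apply: Ex_le_on => // y yx; rewrite ltnNge -Xk' (leq_trans eX) //.
  apply: leq_trans (leq_max_nedges_in _ XS); apply: nedges_mono => e /andP[ees xe].
  by rewrite yx.
have {Xk'}Xk : (#|X| < k)%N by rewrite ltn_neqAle Xk' Xk.
have [Q0|[u uQ]] := set_0Vmem Q.
  (* Processing of [v] is over. Either no active vertex is left and the weight 1 bounds any
     probability, or an active [w] takes its place. *)
  have [A0|[w wA]] := set_0Vmem A.
    rewrite Q0 A0 !cards0 !expr0 mul1r -[leRHS](Ex_cst q es 1 x).
    by apply: Ex_le => // y; case: (_ < _)%N.
  have wX := subsetP AX _ wA.
  have cA : #|A| = #|A :\ w|.+1 by rewrite (cardsD1 w A) wA.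
  rewrite Q0 cards0 expr0 mulr1.
  apply: (@le_trans _ _ (theta ^+ #|A :\ w| * r ^+ #|S :\: X|)).
    apply: (IH es x X (A :\ w) (S :\: X) w) => //.
    - by apply: subset_trans AX; apply: subsetDl.
    - by rewrite !inE eqxx.
    - exact: ltnW.
    - by move=> a b; rewrite !inE => /andP[_ aA] /andP[bX bS]; apply: AU; rewrite // !inE bX.
    - by move=> b bU; apply: AU.
    (* [Q] is refilled with at most [N] vertices while [A] loses one, hence the factor [N.+1] in the
       termination measure. *)
    - have sN : (#|S :\: X| <= N)%N by rewrite -[leqRHS]card_ord max_card.
      move: mm; rewrite Q0 cards0 cA addn0 ltnS; apply: leq_trans.
      by rewrite addSn mulSn [leqRHS]addnC -addnS leq_add2l ltnS.
  rewrite cA exprSr; apply: ler_wpM2l; first exact: exprn_ge0.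
  apply: le_trans r_theta; apply: ler_wiXn2l => //.
  by rewrite cardsD (setIidPr XS) leq_sub2l // ltnW.
have uSX := subsetP QX _ uQ; have /setDP[uS uX] := uSX.
have vS := subsetP XS _ vX.
have ees : edge v u \in es by apply: vQ.
have cQ : #|Q| = #|Q :\ u|.+1 by rewrite (cardsD1 u Q) uQ.
have mem e : e \in es -> e != edge v u -> e \in rem (edge v u) es.
  by move=> ? ?; rewrite mem_rem_uniq // !inE; apply/andP.
have enrem : edge v u \notin rem (edge v u) es by rewrite mem_rem_uniq // !inE eqxx.
have nrem e : e \notin es -> e \notin rem (edge v u) es.
  by apply: contra; apply: mem_rem.
have rev b e : (e \notin es) && x e ->
    (e \notin rem (edge v u) es) && upd x (edge v u) b e.
  move=> /andP[h xe]; rewrite nrem //= upd_other //.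
  by apply: contraNneq h => ->.
rewrite (Ex_rem _ _ _ ees) qp ?edge_in_edge //.
(* Testing one edge preserves the mean weight exactly, because [r = p * theta + (1 - p)]. *)
have -> : theta ^+ #|A| * r ^+ #|Q| = p * (theta ^+ #|A|.+1 * r ^+ #|Q :\ u|)
    + (1 - p) * (theta ^+ #|A| * r ^+ #|Q :\ u|).
  by rewrite cQ !exprS /r; ring.
(* If the edge is present, [u] joins both [X] and [A]; if it is absent, [u] only leaves [Q]. *)
apply: lerD; apply: ler_wpM2l; rewrite ?subr_ge0 //.
  have uA : u \notin A by apply: contra uX; apply: (subsetP AX).
  have cA : #|u |: A| = #|A|.+1 by rewrite cardsU1 uA.
  have cX : #|u |: X| = #|X|.+1 by rewrite cardsU1 uX.
  have sub w : w \in S :\: (u |: X) -> [/\ w \in S :\: X, w != u & w != v].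
    rewrite !inE negb_or -andbA => /and3P[wu wX ->]; rewrite wX wu; split => //.
    by apply: contraNneq wX => ->.
  rewrite -cA; apply: (IH _ _ (u |: X) (u |: A) (Q :\ u) v).
  - exact: rem_uniq.
  - by rewrite subUset sub1set uS.
  - by rewrite setUS.
  - by rewrite !inE vX orbT.
  - by rewrite !inE negb_or vA andbT; apply: contraNneq uX => <-.
  - apply/subsetP => w; rewrite !inE => /andP[wu wQ]; rewrite (negbTE wu) /=.
    by have := subsetP QX _ wQ; rewrite !inE.
  - by rewrite cX.
  - move=> a b /setU1P[->|aA] /sub[bU bu bv].
      apply: mem; first by apply: UU; rewrite // eq_sym.
      by apply: contra_neq bv => /edge_inj[[-> ->]|[_ ->]].
    apply: mem; first exact: AU.
    apply: contraNneq bu => /edge_inj[[_ ->]//|[au _]].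
    by rewrite -au aA in uA.
  - move=> w /setD1P[wu wQ]; apply: mem; first exact: vQ.
    by apply: contra_neq wu => /edge_inj[[_ ->]//|[<- ->]].
  - move=> a b /sub[aU au av] /sub[bU bu bv] ab; apply: mem; first exact: UU.
    by apply: contra_neq av => /edge_inj[[->]//|[ae]]; rewrite ae eqxx in au.
  - rewrite cX /=; set y' := (X in graph_of X).
    have : (#|X|.-1 < nedges (graph_of y') (u |: X))%N.
      apply: leq_ltn_trans (nedges_setU1 uX vX _); last by rewrite /y' enrem upd_same.
      by apply: leq_trans eX _; apply: nedges_mono => e; apply: rev.
    by apply: leq_trans; rewrite -ltnS prednK // card_gt0; apply/set0Pn; exists v.
  - have : #|S :\: X| = #|S :\: (u |: X)|.+1.
      by rewrite (cardsD1 u) uSX setDDl setUC.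
    by move=> sX; move: mm; rewrite sX cA cQ !addnS !addSn ltnS.
apply: (IH _ _ X A (Q :\ u) v) => //.
- exact: rem_uniq.
- by apply: subset_trans QX; apply: subsetDl.
- exact: ltnW.
- move=> a b aA bU; apply: mem; first exact: AU.
  apply: contraNneq vA => /edge_inj[[<- //]|[_ bv]].
  by move: bU; rewrite bv !inE vX.
- move=> w /setD1P[wu wQ]; apply: mem; first exact: vQ.
  by apply: contra_neq wu => /edge_inj[[_ ->]//|[<- ->]].
- move=> a b aU bU ab; apply: mem; first exact: UU.
  apply: contraTneq vX => /edge_inj[[<- _]|[_ <-]].
    by move: aU; rewrite inE => /andP[].
  by move: bU; rewrite inE => /andP[].
- by apply: leq_trans eX _; apply: nedges_mono => e; apply: rev.
- by move: mm; rewrite cQ addnS ltnS.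
Qed.

(** The exploration starts by processing a single vertex with nothing else active, so its initial
    weight is [r ^+ (#|S| - 1)], at most [r ^+ (#|S| - k)]. *)
Lemma exploration_fails_le : (0 < k)%N ->
  Ex q (edges N) (fun y => (max_nedges_in (graph_of y) S k < k.-1)%N%:R)
    (fun=> false) <= theta.
Proof.
move=> k0; have /andP[t0 t1] := theta01; have /andP[p0 p1] := p01.
have /set0Pn[v vS] : S != set0 by rewrite -card_gt0 (leq_trans k0).
apply: (@le_trans _ _ (theta ^+ #|(set0 : {set 'I_N})| * r ^+ #|S :\ v|)).
  have edgeP u w : u != w -> edge u w \in edges N by rewrite mem_edges; apply: edge_lt.
  apply: (@exploration_fails _ _ _ [set v] _ _ v (edges_uniq N)); last exact: ltnSn.
  - by rewrite sub1set.
  - exact: sub0set.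
  - by rewrite inE.
  - by rewrite inE.
  - by [].
  - by rewrite cards1.
  - by move=> u w; rewrite inE.
  - by move=> w; rewrite !inE => /andP[wv _]; rewrite edgeP // eq_sym.
  - by move=> u w _ _; apply: edgeP.
  - by rewrite cards1.
rewrite cards0 mul1r; apply: le_trans r_theta; apply: ler_wiXn2l.
- by rewrite /r; nra.
- by rewrite /r; nra.
- by rewrite (cardsD1 v S) vS leq_subLR; case: (k) k0 => // k' _; rewrite addSn addnC; lia.
Qed.

(** Concentration turns a success probability of at least [1 - theta] into a bound on the mean. Were
    the mean below [k - 1 - d], success would be a deviation by [d], of probability at most
    [k / d ^+ 2 < 1 - theta]. *)
Lemma mean_max_exploration_ge (d : R) : (0 < k)%N -> 0 < d -> k%:R < (1 - theta) * d ^+ 2 ->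
  k.-1%:R - d <= mean_max q S k.
Proof.
move=> k0 d0 kd; set mu := mean_max q S k; rewrite leNgt; apply/negP => mulo.
have := chebyshev_upper (edges N) (fun y => (max_nedges_in (graph_of y) S k)%:R)
  (fun=> false) q01 d0.
move=> /le_trans /(_ (var_max_le_mean q01 kS)); rewrite -/mu.
have kk : k.-1%:R = k%:R - 1 :> R by rewrite -[in RHS](prednK k0) -natr1; lra.
have : 1 - theta <= Ex q (edges N) (fun y =>
    (mu + d <= (max_nedges_in (graph_of y) S k)%:R)%R%:R) (fun=> false).
  have := exploration_fails_le k0; set F := Ex _ _ _ _ => Fle.
  rewrite lerBlDr -lerBlDl; apply: le_trans Fle.
  rewrite -[X in X - _](Ex_cst q (edges N) 1 (fun=> false)) -ExB; apply: Ex_le => // y.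
  case: ltnP => h; first by rewrite mulr1n lerBlDl lerDr ler0n.
  rewrite mulr0n subr_le0 ler1n lt0b.
  by apply: le_trans (_ : k.-1%:R <= _); rewrite ?ler_nat //; lra.
set P := Ex _ _ _ _ => Ple.
have : (1 - theta) * d ^+ 2 <= P * d ^+ 2 by apply: ler_wpM2r; rewrite ?sqr_ge0.
by lra.
Qed.

End Exploration.

(** * Planted sets of supercritical density *)

Definition planted (R : realFieldType) N (p0 p1 : R) (S : {set 'I_N})
  (e : 'I_N * 'I_N) : R := if edge_in S e then p1 else p0.

Lemma planted_proba (R : realFieldType) N (p0 p1 : R) (S : {set 'I_N}) :
  0 <= p0 <= 1 -> 0 <= p1 <= 1 -> is_proba (planted p0 p1 S).
Proof. by move=> p01 p11 e; rewrite /planted; case: ifP. Qed.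

(* The planted graph is the union of a graph with edge density [p'], in which
   the exploration finds [k] vertices spanning at least [k - 1] edges, and of an
   independent one of density at least [rho]. *)
Lemma mean_max_planted_ge (R : realFieldType) N (S : {set 'I_N}) k
    (p0 p1 p' rho theta d : R) :
  0 <= p0 <= 1 -> p1 <= 1 -> 0 <= p' < 1 -> 0 <= rho -> p' + rho <= p1 ->
  0 <= theta <= 1 -> (0 < k <= #|S|)%N ->
  (1 - p' * (1 - theta)) ^+ (#|S| - k) <= theta ->
  0 < d -> k%:R < (1 - theta) * d ^+ 2 ->
  (1 - rho) * (k.-1%:R - d) + rho * ((k * k.-1)%:R / 2) <=
    mean_max (planted p0 p1 S) S k.
Proof.
move=> p01 p11 /andP[p'0 p'1] rho0 pp1 t01 /andP[k0 kS] rt d0 kd.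
have q1P : is_proba (planted p0 p' S).
  by apply: planted_proba => //; rewrite p'0 ltW.
have p'V : 0 < 1 - p' by rewrite subr_gt0.
(* The second density solves [1 - p1 = (1 - p') * (1 - x)], so it is at least [p1 - p']. *)
have rhoq : rho <= (p1 - p') / (1 - p') by rewrite ler_pdivlMr //; nra.
have q2P : is_proba (planted 0 ((p1 - p') / (1 - p')) S).
  apply: planted_proba; first by rewrite lexx ler01.
  by rewrite (le_trans rho0 rhoq) /= ler_pdivrMr //; lra.
have qq e : 1 - planted p0 p1 S e =
    (1 - planted p0 p' S e) * (1 - planted 0 ((p1 - p') / (1 - p')) S e).
  rewrite /planted; case: ifP => _; last by rewrite subr0 mulr1.
  by field; rewrite lt0r_neq0.
have rq e : edge_in S e -> rho <= planted 0 ((p1 - p') / (1 - p')) S e.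
  by rewrite /planted => ->.
apply: le_trans (mean_max_sprinkle q1P q2P qq kS rq).
rewrite lerD2r; apply: ler_wpM2l; first by lra.
apply: (mean_max_exploration_ge q1P (p := p') (theta := theta)) => //.
  by move=> e eS; rewrite /planted eS.
by rewrite p'0 ltW.
Qed.

Lemma exp_1sub_le (R : realType) (x : R) m : x <= 1 -> (1 - x) ^+ m <= expR (- x * m%:R).
Proof.
move=> x1; rewrite [- x * _]mulrC expRM_natl; apply: lerXn2r.
- by rewrite nnegrE subr_ge0.
- by rewrite nnegrE expR_ge0.
- exact: expR_ge1Dx.
Qed.

(** The excess [3 * g] is split into [2 * g] for the exploration and [g] for the sprinkling. The
    constants depend on [g] only, which makes the bound uniform in [N] and [S]. *)
Lemma giant_density (R : realType) (g : R) : 0 < g ->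
  exists eps delta n0 : R, [/\ 0 < eps, 0 < delta &
    forall N (S : {set 'I_N}) p0 p1, n0 <= #|S|%:R ->
      0 <= p0 <= 1 -> p1 <= 1 -> 1 + 3 * g <= #|S|%:R * p1 ->
      exists k, [/\ (0 < k <= #|S|)%N, delta * #|S|%:R <= k%:R &
        (1 + eps) * k%:R <= mean_max (planted p0 p1 S) S k] ].
Proof.
(* At density [(1 + 2 * g) / n], setting aside a fraction [dl] of the vertices costs [g] in mean
   offspring and leaves at least [1 + g]. *)
move=> g0; set dl := g / (1 + 2 * g).
have g2 : 0 < 1 + 2 * g by lra.
have dl0 : 0 < dl by rewrite divr_gt0.
have dl1 : dl <= 1 by rewrite ler_pdivrMr //; lra.
have dlE : dl * (1 + 2 * g) = g by rewrite /dl divfK // lt0r_neq0.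
set eta := g * dl / 8; have eta0 : 0 < eta by apply: divr_gt0; [exact: mulr_gt0|lra].
(* Here [(1 - theta) * (1 + g) = g], and [expR (- g) <= (1 + g)^-1 = theta] yields the hypothesis of
   the exploration. *)
set theta := (1 + g)^-1.
have t0 : 0 < theta by rewrite invr_gt0; lra.
have tE : theta * (1 + g) = 1 by rewrite mulVf // lt0r_neq0; lra.
have t1 : theta < 1 by nra.
have tt : 0 < (1 - theta) * eta ^+ 2 by rewrite mulr_gt0 ?exprn_gt0 ?subr_gt0.
(* For [k >= K], the middle term gives [1 <= eta * k] and the last one [k < (1 - theta) * d ^+ 2]
   with [d = eta * k]. *)
set K := 1 + eta^-1 + ((1 - theta) * eta ^+ 2)^-1.
have iv1 : 0 < eta^-1 by rewrite invr_gt0.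
have iv2 : 0 < ((1 - theta) * eta ^+ 2)^-1 by rewrite invr_gt0.
have K0 : 1 < K by rewrite /K; lra.
(* Halving [dl] absorbs the rounding of [k]. The terms of the threshold ensure in turn
   [2 * K <= dl * n], [p' < 1] and [rho <= eta / 2]. *)
exists eta, (dl / 2), (2 * K / dl + 2 + 2 * g + 2 * g / eta); split => //; first by lra.
move=> N S p0 p1 nlarge p01 p11 np; set n : R := #|S|%:R in nlarge np *.
have h1 : 0 <= 2 * K / dl by rewrite !mulr_ge0 ?invr_ge0; lra.
have h2 : 0 <= 2 * g / eta by rewrite !mulr_ge0 ?invr_ge0; lra.
have n0 : 0 < n by lra.
have Kn : 2 * K <= dl * n.
  by rewrite [dl * n]mulrC -ler_pdivrMr //; lra.
set k := Num.truncn (dl * n).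
have dn0 : 0 <= dl * n by rewrite mulr_ge0 ?ltW.
have /andP[k1 k2] := truncn_itv dn0.
rewrite -/k -natr1 in k1 k2.
have kK : K <= k%:R by lra.
have kgt0 : (0 < k)%N by rewrite -(ltr_nat R); lra.
have kn : (k <= #|S|)%N by rewrite -(ler_nat R) -/n; nra.
exists k; split; [by rewrite kgt0 | by lra | ].
have kR : k.-1%:R = k%:R - 1 :> R by rewrite -[in RHS](prednK kgt0) -natr1; lra.
set rho := g / n; set p' := (1 + 2 * g) / n.
have rhoE : rho * n = g by rewrite divfK // lt0r_neq0.
have pE : p' * n = 1 + 2 * g by rewrite divfK // lt0r_neq0.
have rho0 : 0 < rho by rewrite divr_gt0.
have p'0 : 0 < p' by rewrite divr_gt0.
have p'1 : p' < 1 by rewrite ltr_pdivrMr //; lra.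
have eK : 1 <= eta * k%:R.
  by rewrite mulrC -ler_pdivrMr // mul1r; apply: le_trans kK; rewrite /K; lra.
apply: le_trans (mean_max_planted_ge (p' := p') (rho := rho) (theta := theta)
   (d := eta * k%:R) p01 p11 _ _ _ _ _ _ _ _).
(* Per vertex, sprinkling gains [7 * eta / 2]. Rounding and [d] cost [eta] each and the factor
   [1 - rho] at most [eta / 2], so [eta] remains. *)
- rewrite natrM kR.
  have rn : rho <= eta / 2.
    rewrite -(ler_pM2r n0) rhoE.
    have : 2 * g / eta <= n by lra.
    by rewrite ler_pdivrMr //; lra.
  have rk : 7 * eta <= rho * (k%:R - 1).
    have : rho * (dl * n - 2) <= rho * (k%:R - 1) by apply: ler_wpM2l; lra.
    have -> : rho * (dl * n - 2) = 8 * eta - 2 * rho.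
      by rewrite mulrBr (mulrC dl) mulrA rhoE /eta; field.
    lra.
  have a1 : k%:R * (7 * eta) <= k%:R * (rho * (k%:R - 1)) by apply: ler_wpM2l; lra.
  have a2 : rho * k%:R <= eta / 2 * k%:R by apply: ler_wpM2r; lra.
  have a3 : 0 <= rho * (1 + eta * k%:R) by rewrite mulr_ge0; lra.
  lra.
- by rewrite p'1 ltW.
- exact: ltW.
- have : (p' + rho) * n <= p1 * n by rewrite mulrDl pE rhoE; lra.
  by rewrite ler_pM2r.
- by rewrite !ltW.
- by rewrite kgt0.
- have pt : p' * (1 - theta) <= 1 by nra.
  apply: (le_trans (exp_1sub_le _ pt)).
  have : g <= p' * (1 - theta) * (#|S| - k)%:R.
    rewrite natrB // -/n.
    have a1 : 1 + g <= p' * (n - k%:R).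
      have : p' * k%:R <= p' * (dl * n) by apply: ler_wpM2l => //; exact: ltW.
      by rewrite (mulrC dl) mulrA mulrBr pE; lra.
    have a2 : (1 - theta) * (1 + g) = g by lra.
    by rewrite -mulrA (mulrC (1 - theta)) mulrA -[leLHS]a2 mulrC; apply: ler_wpM2r => //; lra.
  move=> gp; apply: (@le_trans _ _ (expR (- g))); first by rewrite ler_expR; lra.
  rewrite expRN lef_pV2 ?posrE ?expR_gt0 //; last by lra.
  exact: expR_ge1Dx.
- by rewrite mulr_gt0 //; lra.
- have : 1 < (1 - theta) * eta ^+ 2 * k%:R.
    by rewrite mulrC -ltr_pdivrMr // mul1r; apply: lt_le_trans kK; rewrite /K; lra.
  move=> h; have k0 : 0 < k%:R :> R by lra.
  rewrite exprMn mulrA [k%:R ^+ 2]expr2 mulrA -[ltLHS]mul1r.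
  by rewrite ltr_pM2r.
Qed.

(** * The scan under the null and under the alternative *)

(** The binomial coefficient is at most [N ^ k / k!], and [k ^ k / k!] is a single term of the
    exponential series at [k]. *)
Lemma bin_le_exp (R : realType) N k : (0 < k)%N ->
  'C(N, k)%:R <= (N%:R / k%:R * expR 1) ^+ k :> R.
Proof.
move=> k0; have k0R : 0 < k%:R :> R by rewrite ltr0n.
have f0 : 0 < k`!%:R :> R by rewrite ltr0n fact_gt0.
have h1 : 'C(N, k)%:R * k`!%:R <= N%:R ^+ k :> R.
  rewrite -natrM bin_ffact -natrX ler_nat ffact_prod.
  rewrite -[X in (_ <= _ ^ X)%N]card_ord -prod_nat_const.
  by apply: leq_prod => i _; apply: leq_subr.
have h2 : k%:R ^+ k / k`!%:R <= expR 1 ^+ k :> R.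
  rewrite -expRM_natl mulr1; case: k k0 {k0R f0 h1} => // k _.
  by have := @expR_ge1Dxn R k.+1%:R k (ler0n _ _); lra.
have h3 : k%:R ^+ k <= expR 1 ^+ k * k`!%:R :> R by rewrite -ler_pdivrMr.
rewrite exprMn expr_div_n mulrAC ler_pdivlMr ?exprn_gt0 //.
apply: le_trans (ler_wpM2l (ler0n _ _) h3) _; rewrite mulrCA [leLHS]mulrC.
by apply: ler_wpM2r h1; rewrite exprn_ge0 ?expR_ge0.
Qed.

(** Markov's inequality for the exponential of [s] times the edge count; each pair in [T]
    contributes [1 - p0 + p0 * expR s <= expR (p0 * expR s)]. *)
Lemma chernoff_null (R : realType) N (p0 s a : R) (T : {set 'I_N}) :
  0 <= p0 <= 1 -> 0 <= s ->
  Ex (fun=> p0) (edges N) (fun y => (a <= (nedges (graph_of y) T)%:R)%R%:R)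
    (fun=> false) <= expR (p0 * expR s * ((#|T| * #|T|.-1)%:R / 2) - s * a).
Proof.
move=> /andP[p00 p01] s0.
have q01 : @is_proba R ('I_N * 'I_N)%type (fun=> p0) by move=> e; rewrite p00.
set h := fun e b => if edge_in T e && b then expR s else 1.
apply: (@le_trans _ _ (Ex (fun=> p0) (edges N) (fun y =>
   expR (- (s * a)) * \prod_(e <- edges N) h e (y e)) (fun=> false))).
  apply: Ex_le => // y.
  have -> : \prod_(e <- edges N) h e (y e) = expR (s * (nedges (graph_of y) T)%:R).
    rewrite nedges_graph_of natr_sum mulr_sumr expR_sum [RHS]big_mkcond /=.
    apply: eq_bigr => e _; rewrite /h; case: (edge_in T e) => //=.
    by case: (y e); rewrite ?mulr1 ?mulr0 ?expR0.
  rewrite -expRD; case: (lerP a) => [ha|_]; last exact: expR_ge0.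
  by rewrite -[leLHS]expR0 ler_expR addrC subr_ge0 ler_wpM2l.
rewrite ExZ Ex_prod ?edges_uniq // [_ - s * a]addrC expRD; apply: ler_wpM2l; first exact: expR_ge0.
have -> : (#|T| * #|T|.-1)%:R / 2 = (\sum_(e <- edges N | edge_in T e) 1)%N%:R :> R.
  by rewrite -card_edges_in natrM mulrC mulKf // pnatr_eq0.
rewrite natr_sum mulr_sumr expR_sum [leRHS]big_mkcond /=.
apply: ler_prod => e _; rewrite /h; case: (edge_in T e) => /=; last by apply/andP; split; lra.
rewrite !mulr1; have := expR_ge1Dx (p0 * expR s).
have : 0 <= p0 * expR s by rewrite mulr_ge0 ?expR_ge0.
by move=> h1 h2; apply/andP; split; lra.
Qed.

Lemma geometric_le (R : realFieldType) (b : R) n : 0 <= b <= 1 / 2 ->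
  \sum_(1 <= k < n.+1) b ^+ k <= 2 * b.
Proof.
move=> /andP[b0 b2]; elim: n => [|n IH].
  by rewrite big_geq //; lra.
rewrite big_nat_recl // expr1.
have -> : \sum_(1 <= i < n.+1) b ^+ i.+1 = b * \sum_(1 <= i < n.+1) b ^+ i.
  by rewrite mulr_sumr; apply: eq_bigr => i _; rewrite exprS.
by nra.
Qed.

(** Positivity of [t] excludes the default value 0 of an empty maximum. *)
Lemma scan_sup_ge (R : realType) N n (f : nat -> R) t : 0 < t ->
  t <= scan_sup N n f ->
  exists2 k, (k <= n)%N /\ n%:R / loglog_ratio R N n <= k%:R & t <= f k.
Proof.
move=> t0; rewrite /scan_sup => tf; apply: contrapT => H.
suff : \big[Num.max/0]_(k < n.+1 | n%:R / loglog_ratio R N n <= k%:R) f k < t.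
  by rewrite ltNge tf.
apply: bigmax_lt => // k nk; rewrite ltNge; apply/negP => tfk.
by apply: H; exists k => //; split => //; rewrite -ltnS ltn_ord.
Qed.

Lemma max_nedges_ge (R : realType) N (W : 'M[bool]_N) k (a : R) : 0 < a ->
  a <= (max_nedges W k)%:R ->
  exists2 T : {set 'I_N}, #|T| = k & a <= (nedges W T)%:R.
Proof.
move=> a0 am; apply: contrapT => H.
suff : (max_nedges W k)%:R < a by rewrite ltNge am.
rewrite /max_nedges; elim/big_ind: _ => // [m m' ma ma'|T /eqP Tk].
  by rewrite /maxn; case: ifP.
by rewrite ltNge; apply/negP => aT; apply: H; exists T.
Qed.

(** Union bound over the sets of each size [k], which together contribute at most [b ^+ k]. In the
    exponent [3 / 2], 1 comes from the binomial bound and [1 / 2] from Chernoff's, as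
    [p0 * expR s * k <= 1]; the factor [u] comes from [k >= n / u]. *)
Lemma broad_scan_null_le (R : realType) N n (p0 s t b : R) :
  let u := loglog_ratio R N n in
  0 <= p0 <= 1 -> (0 < n)%N -> 0 < u -> 0 <= s -> p0 * expR s * n%:R <= 1 ->
  0 < t -> N%:R / n%:R * u * expR (3 / 2) * expR (- (s * t)) <= b -> b <= 1 / 2 ->
  graph_prob (null_edge p0) (fun W : 'M[bool]_N => t <= broad_scan R n W) <= 2 * b.
Proof.
move=> u p01 n0 u0 s0 psn t0; set c := (X in X <= b) => cb b2.
have n0R : 0 < n%:R :> R by rewrite ltr0n.
have c0 : 0 <= c.
  by rewrite !mulr_ge0 ?expR_ge0 ?invr_ge0 ?ler0n // ltW.
have b0 : 0 <= b := le_trans c0 cb.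
rewrite graph_probE graph_expectE.
have q01 : @is_proba R ('I_N * 'I_N)%type (fun=> p0) by move=> e.
apply: (@le_trans _ _ (Ex (fun=> p0) (edges N) (fun y =>
   \sum_(1 <= k < n.+1 | n%:R / u <= k%:R) \sum_(T : {set 'I_N} | #|T| == k)
     (t * k%:R <= (nedges (graph_of y) T)%:R)%R%:R) (fun=> false))).
  apply: Ex_le => // y; case: (lerP t) => [ty|_]; last first.
    by rewrite sumr_ge0 // => k _; rewrite sumr_ge0.
  have [k [kn nk] tk] := scan_sup_ge t0 ty.
  have k0R : 0 < k%:R :> R by apply: lt_le_trans nk; rewrite divr_gt0.
  have k0 : (0 < k)%N by rewrite -(ltr_nat R).
  rewrite ler_pdivlMr // in tk.
  have [T /eqP Tk tT] := max_nedges_ge (mulr_gt0 t0 k0R) tk.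
  rewrite big_mkcond (bigD1_seq k) ?mem_index_iota ?k0 ?iota_uniq //= nk.
  rewrite (bigD1 T) //= tT mulr1n -addrA lerDl addr_ge0 ?sumr_ge0 // => m _.
  by case: ifP => // _; rewrite sumr_ge0.
rewrite Ex_sum; apply: le_trans (geometric_le n _); last by rewrite b0.
rewrite big_mkcond /= big_nat_cond [leRHS]big_nat_cond; apply: ler_sum => k.
rewrite andbT => /andP[k0 kn]; case: ifP => [nk|_]; last exact: exprn_ge0.
have k0R : 0 < k%:R :> R by rewrite ltr0n.
rewrite Ex_sum.
apply: (@le_trans _ _ (\sum_(T : {set 'I_N} | #|T| == k)
    (expR (1 / 2) * expR (- (s * t))) ^+ k)).
  apply: ler_sum => T /eqP Tk; apply: le_trans (chernoff_null _ _ p01 s0) _.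
  rewrite -expRD -expRM_natl ler_expR Tk.
  have : p0 * expR s * (k * k.-1)%:R <= k%:R.
    rewrite natrM mulrCA -[leRHS]mulr1; apply: ler_wpM2l; first exact: ltW.
    apply: le_trans psn; apply: ler_wpM2l; last by rewrite ler_nat (leq_trans (leq_pred k)).
    by rewrite mulr_ge0 ?expR_ge0 //; case/andP: p01.
  by nra.
rewrite sumr_const -[X in _ *+ X]/#|[pred T : {set 'I_N} | #|T| == k]|.
rewrite (_ : #|_| = 'C(N, k)); last first.
  by rewrite -[in RHS](card_ord N) -card_draws; apply: eq_card => T; rewrite !inE.
rewrite -[leLHS]mulr_natl.
apply: (@le_trans _ _ (c ^+ k)); last by rewrite lerXn2r // nnegrE.
apply: (@le_trans _ _ ((N%:R / k%:R * expR 1) ^+ k *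
   (expR (1 / 2) * expR (- (s * t))) ^+ k)).
  apply: ler_wpM2r; last exact: bin_le_exp.
  by rewrite exprn_ge0 ?mulr_ge0 ?expR_ge0.
rewrite -exprMn; apply: lerXn2r; rewrite ?nnegrE //.
rewrite /c mulrA; apply: ler_wpM2r; first exact: expR_ge0.
rewrite -[leLHS]mulrA -expRD (_ : 1 + 1 / 2 = 3 / 2 :> R); last by field.
apply: ler_wpM2r; first exact: expR_ge0.
rewrite -[leRHS]mulrA; apply: ler_wpM2l; first exact: ler0n.
rewrite -[k%:R^-1]mul1r ler_pdivrMr // -mulrA mulrC ler_pdivlMr // mul1r.
by rewrite mulrC -ler_pdivrMr.
Qed.

Lemma scan_sup_le (R : realType) N n (f : nat -> R) k :
  (k <= n)%N -> n%:R / loglog_ratio R N n <= k%:R -> f k <= scan_sup N n f.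
Proof.
move=> kn nk; have kn' : (k < n.+1)%N by [].
exact: (bigmax_sup (Ordinal kn')).
Qed.

Lemma mean_maxE (R : realType) N (p0 p1 : R) (S : {set 'I_N}) k :
  graph_expect (planted_edge p0 p1 S) (fun W => (max_nedges_in W S k)%:R) =
  mean_max (planted p0 p1 S) S k.
Proof. by rewrite graph_expectE. Qed.

(** A miss forces the maximum inside [S] at size [k] to fall [d * mu] below its mean [mu]; its
    variance is at most [mu]. *)
Lemma broad_scan_planted_le (R : realType) N (p0 p1 t d : R) (S : {set 'I_N}) k :
  let mu := mean_max (planted p0 p1 S) S k in
  0 <= p0 <= 1 -> 0 <= p1 <= 1 -> 0 < d -> 0 < mu -> (0 < k <= #|S|)%N ->
  #|S|%:R / loglog_ratio R N #|S| <= k%:R -> t * k%:R <= (1 - d) * mu ->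
  graph_prob (planted_edge p0 p1 S) (fun W => ~~ (t <= broad_scan R #|S| W))
    <= (d ^+ 2 * mu)^-1.
Proof.
move=> mu p01 p11 d0 mu0 /andP[k0 kS] nk tk.
have q01 := planted_proba S p01 p11.
have k0R : 0 < k%:R :> R by rewrite ltr0n.
rewrite graph_probE graph_expectE -[fun e => _]/(planted p0 p1 S).
have dmu : 0 < d * mu by rewrite mulr_gt0.
have := chebyshev_lower (edges N) (fun y => (max_nedges_in (graph_of y) S k)%:R)
  (fun=> false) q01 dmu.
move=> /le_trans /(_ (var_max_le_mean q01 kS)); rewrite -/(mean_max (planted p0 p1 S) S k) -/mu; set P := Ex _ _ _ _ => Pmu.
apply: (@le_trans _ _ P); last first.
  rewrite -[leRHS]mul1r ler_pdivlMr ?mulr_gt0 ?exprn_gt0 //.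
  rewrite -(ler_pM2r mu0) mul1r; apply: le_trans Pmu; rewrite le_eqVlt; apply/orP; left.
  by apply/eqP; ring.
apply: Ex_le => // y; rewrite -ltNge; case: ltP => // h; rewrite mulr1n ler1n lt0b.
have := le_lt_trans (scan_sup_le (N := N)
   (fun k => (max_nedges (graph_of y) k)%:R / k%:R) kS nk) h.
rewrite ltr_pdivrMr // => h'.
have : (max_nedges_in (graph_of y) S k)%:R <= (max_nedges (graph_of y) k)%:R :> R.
  by rewrite ler_nat leq_max_nedges.
lra.
Qed.

(** * Invariance under relabelling of the vertices *)

Lemma big_edges_perm (T : Type) (idx : T) (op : Monoid.com_law idx) N
    (s : {perm 'I_N}) (F : 'I_N -> 'I_N -> T) : (forall i j, F i j = F j i) ->
  \big[op/idx]_(e <- edges N) F (s e.1) (s e.2) =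
  \big[op/idx]_(e <- edges N) F e.1 e.2.
Proof.
move=> Fsym; rewrite !big_edges /=.
have edgeE (u : {perm 'I_N}) (e : 'I_N * 'I_N) : (e.1 < e.2)%N ->
    edge (u^-1%g (edge (u e.1) (u e.2)).1) (u^-1%g (edge (u e.1) (u e.2)).2) = e.
  case: e => i j /= ij; rewrite {2 3}/edge; case: ifP => _ /=; rewrite !permK.
    by rewrite /edge ij.
  by rewrite edgeC /edge ij.
rewrite [RHS](reindex_onto (fun e : 'I_N * 'I_N => edge (s e.1) (s e.2))
    (fun e : 'I_N * 'I_N => edge (s^-1%g e.1) (s^-1%g e.2))) /=; last first.
  by move=> e /andP[e12 _]; rewrite -[in RHS](edgeE s^-1%g e e12) invgK.
apply: eq_big => [e|e _]; last by rewrite /edge; case: ifP => _ //=; rewrite Fsym.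
rewrite !andbT; apply/idP/andP => [e12|[he /eqP <-]].
  by rewrite edgeE // eqxx edge_lt // (inj_eq perm_inj) neq_ltn e12.
by rewrite edge_lt // (inj_eq perm_inj) neq_ltn he.
Qed.

(** List each set followed by its complement and match the two lists position by position. *)
Lemma perm_between N (S S' : {set 'I_N}) : #|S| = #|S'| ->
  exists s : {perm 'I_N}, forall i, (s i \in S') = (i \in S).
Proof.
move=> SS; pose r (A : {set 'I_N}) := enum A ++ enum (~: A).
have ru A : uniq (r A).
  rewrite cat_uniq !enum_uniq /= andbT; apply/hasPn => i.
  by rewrite !mem_enum inE.
have rs A : size (r A) = N.
  by rewrite size_cat -!cardE cardsC card_ord.
have rm A i : i \in r A by rewrite mem_cat !mem_enum inE orbN.
have im i : (index i (r S) < size (r S'))%N.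
  by have := rm S i; rewrite -index_mem !rs.
have si : injective (fun i => nth i (r S') (index i (r S))).
  move=> i j; rewrite (set_nth_default j) // => /eqP.
  by rewrite nth_uniq // => /eqP; apply: index_inj.
exists (perm si) => i; rewrite permE nth_cat.
have E : (index i (r S) < size (enum S'))%N = (i \in S).
  rewrite -cardE -SS /r index_cat mem_enum cardE; case: ifP => iS.
    by rewrite index_mem mem_enum.
  by rewrite ltnNge leq_addr.
case: ifP => lt; first by rewrite -mem_enum mem_nth // -E lt.
rewrite -E lt; apply: negbTE; rewrite -in_setC -mem_enum mem_nth //.
by have := im i; rewrite size_cat ltn_subLR // leqNgt lt.
Qed.

(** Relabelling preserves the mass of a graph and carries subsets of [S] to subsets of [S'] with as
    many edges. This transfers a signal known for one planted set to all sets over which the risk is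
    maximized. *)
Lemma mean_max_le_card (R : realType) N (p0 p1 : R) (S S' : {set 'I_N}) k :
  0 <= p0 <= 1 -> 0 <= p1 <= 1 -> #|S| = #|S'| ->
  mean_max (planted p0 p1 S) S k <= mean_max (planted p0 p1 S') S' k.
Proof.
move=> p01 p11 /perm_between[s sS].
pose h (s : {perm 'I_N}) (W : 'M[bool]_N) := \matrix_(i, j) W (s i) (s j).
rewrite -!mean_maxE /graph_expect (reindex_onto (h s) (h s^-1%g)) /=; last first.
  by move=> W _; apply/matrixP => i j; rewrite !mxE !permK.
have hh W : h s^-1%g (h s W) == W.
  by apply/eqP/matrixP => i j; rewrite !mxE !permKV.
have hsimple W : simple_graph (h s W) = simple_graph W.
  rewrite /simple_graph; congr andb.
    apply/eqP/eqP => /matrixP E; apply/matrixP => i j; last by rewrite !mxE E mxE.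
    by have := E (s^-1%g i) (s^-1%g j); rewrite !mxE !permKV.
  apply/forallP/forallP => E i; last by rewrite mxE E.
  by have := E (s^-1%g i); rewrite mxE permKV.
under eq_bigl do rewrite hh hsimple andbT.
apply: ler_sum => W /andP[/eqP Wsym _].
have massE : graph_mass (planted_edge p0 p1 S) (h s W) =
             graph_mass (planted_edge p0 p1 S') W.
  have massL q V : graph_mass q V = \prod_(e <- edges N)
      if V e.1 e.2 then q e.1 e.2 else 1 - q e.1 e.2 :> R.
    by rewrite /graph_mass pair_big_dep big_edges; apply: eq_bigl => e; rewrite andbT.
  rewrite !massL -(big_edges_perm _ s (F := fun i j => if W i j then
      planted_edge p0 p1 S' i j else 1 - planted_edge p0 p1 S' i j)); last first.
    by move=> i j; rewrite {1}Wsym mxE /planted_edge andbC.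
  by apply: eq_bigr => e _; rewrite mxE /planted_edge !sS.
rewrite massE; apply: ler_wpM2l.
  rewrite /graph_mass prodr_ge0 // => i _; rewrite prodr_ge0 // => j _.
  rewrite /planted_edge; case/andP: p01 => ? ?; case/andP: p11 => ? ?.
  by do 2 case: ifP => _; rewrite ?subr_ge0.
rewrite ler_nat; apply/bigmax_leqP => T /andP[TS /eqP Tk].
have -> : nedges (h s W) T = nedges W (s @: T).
  rewrite !nedgesE big_mkcond [RHS]big_mkcond /=.
  rewrite -(big_edges_perm _ s (F := fun i j =>
    if edge_in (s @: T) (i, j) then W i j : nat else 0%N)); last first.
    by move=> i j; rewrite {1}Wsym mxE /edge_in andbC.
  by apply: eq_bigr => e _; rewrite mxE /edge_in /= !mem_imset //; exact: perm_inj.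
have cT : #|s @: T| = #|T| by apply: card_imset; exact: perm_inj.
rewrite -Tk -cT.
apply: leq_max_nedges_in; apply/subsetP => _ /imsetP[i iT ->].
by rewrite sS (subsetP TS).
Qed.

(** * Asymptotics *)

Local Open Scope classical_set_scope.

Lemma risk_le (R : realType) N n (p0 p1 eps : R) :
  let l := ln (N%:R / n%:R) : R in
  let a := alpha N n p0 in
  let B := 8 * expR (3 / 2) / eps ^+ 2 in
  0 < eps -> 0 < p0 -> p0 < p1 -> p1 <= 1 -> (0 < n)%N ->
  1 <= N%:R ^+ 2 * p0 -> 0 < ln l -> B / l <= 1 / 2 -> a < 1 ->
  (forall S : {set 'I_N}, #|S| = n -> exists k,
     [/\ (0 < k <= n)%N, n%:R / loglog_ratio R N n <= k%:R &
      (1 + eps) * k%:R <= (1 - a) * mean_max (planted p0 p1 S) S k]) ->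
  risk n p0 p1 (fun W : 'M[bool]_N => (1 + eps / 2) / (1 - a) <= broad_scan R n W)
    <= 2 * (B / l) + 2 * ln N%:R / (((eps / 2) / (1 + eps)) ^+ 2 * n%:R).
Proof.
move=> l a B eps0 p00 p01 p11 n0 Np0 u0 Bl a1 HS.
have n0R : 0 < n%:R :> R by rewrite ltr0n.
have l1 : 1 < l by rewrite ltNge; apply/negP => /ln_le0; lra.
have l0 : 0 < l by lra.
have N0R : 0 < N%:R :> R.
  rewrite lt0r ler0n andbT; apply/eqP => N0.
  by move: l0; rewrite /l N0 mul0r ltNge ln_le0.
have N1 : 1 <= N%:R :> R by move: N0R; rewrite ltr0n ler1n.
have lnN : 0 <= ln N%:R :> R by exact: ln_ge0.
have Nn0 : 0 < N%:R / n%:R :> R by rewrite divr_gt0.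
have a1' : 0 < 1 - a by rewrite subr_gt0.
have al : (1 - a) * l = l - ln (N%:R * p0).
  by rewrite mulrBl mul1r /a /alpha -/l divfK // lt0r_neq0.
have el : expR l = N%:R / n%:R by rewrite /l lnK ?posrE.
set t := (1 + eps / 2) / (1 - a).
have t0 : 0 < t by rewrite divr_gt0 //; lra.
have ta : t * (1 - a) = 1 + eps / 2 by rewrite divfK // lt0r_neq0.
have p01' : 0 <= p0 <= 1 by apply/andP; split; lra.
have p11' : 0 <= p1 <= 1 by apply/andP; split; lra.
apply: lerD.
  (* By definition of [alpha], this [s] equals [- ln (n * p0)], so that [p0 * expR s * n = 1]. *)
  apply: (broad_scan_null_le p01' n0 (s := (1 - a) * l) u0) => //.
  - by rewrite ltW // mulr_gt0.
  - rewrite al expRD expRN el lnK ?posrE ?mulr_gt0 //.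
    rewrite (_ : _ * n%:R = 1) //.
    by field; rewrite !lt0r_neq0.
  - rewrite [_ * l * t]mulrAC [_ * t]mulrC ta -el.
    (* Since [s * t = (1 + eps / 2) * l], what remains is [ln l * expR (3 / 2) * expR (- x)]. The
       bounds [expR (- x) <= 2 / x ^+ 2] and [ln l <= l] give [B / l], whence the 8 in [B]. *)
    set x := eps / 2 * l.
    have x0 : 0 < x by rewrite mulr_gt0 //; lra.
    have -> : - ((1 + eps / 2) * l) = - l + - x by rewrite /x; ring.
    rewrite /loglog_ratio -/l expRD !expRN.
    have := @expR_ge1Dxn R x 1 (ltW x0).
    have := expR_gt0 l; have := expR_gt0 x; have := expR_gt0 (3 / 2 : R).
    set E := expR x; set L := expR l; set E3 := expR (3 / 2) => E30 E0 L0 Ex.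
    have E2 : x ^+ 2 / 2 <= E by move: Ex; rewrite (_ : 2`! = 2)%N //; lra.
    have -> : L * ln l * E3 * (L^-1 / E) = ln l * E3 / E.
      by field; rewrite !lt0r_neq0.
    rewrite ler_pdivrMr //.
    apply: (@le_trans _ _ (B / l * (x ^+ 2 / 2))).
      have -> : B / l * (x ^+ 2 / 2) = l * E3.
        by rewrite /B /x -/E3; field; rewrite !lt0r_neq0.
      by apply: ler_wpM2r; rewrite ltW // ln_sublinear.
    apply: ler_wpM2l => //.
    by rewrite !divr_ge0 ?mulr_ge0 ?sqr_ge0 // ltW.
apply: bigmax_le => [|S /eqP Sn].
  by apply: divr_ge0; apply: mulr_ge0; rewrite ?sqr_ge0.
have [k [/andP[k0 kn] nk muk]] := HS S Sn.
have k0R : 0 < k%:R :> R by rewrite ltr0n.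
set mu := mean_max _ _ _ in muk.
have mu0 : 0 < mu by rewrite -(pmulr_rgt0 _ a1'); apply: lt_le_trans muk; rewrite mulr_gt0 //; lra.
(* Chosen so that [(1 - d) * (1 + eps) = 1 + eps / 2], the numerator of the critical value. *)
set d := eps / 2 / (1 + eps).
have e1 : 0 < 1 + eps by lra.
have d0 : 0 < d by rewrite divr_gt0 //; lra.
have dE : d * (1 + eps) = eps / 2 by rewrite divfK // lt0r_neq0.
rewrite -{1}Sn; apply: le_trans (broad_scan_planted_le p01' p11' d0 mu0 _ _ _) _.
- by rewrite k0 Sn.
- by rewrite Sn.
- rewrite -/mu -(ler_pM2r a1') mulrAC ta.
  have : (1 - d) * ((1 + eps) * k%:R) <= (1 - d) * ((1 - a) * mu).
    apply: ler_wpM2l => //; nra.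
  have -> : (1 - d) * ((1 + eps) * k%:R) = (1 + eps - d * (1 + eps)) * k%:R by ring.
  rewrite dE; lra.
rewrite -/mu.
(* It remains to bound [mu] from below. As [alpha] may be very negative, [1 - a] is controlled
   through [N ^ 2 * p0 >= 1], which gives [(1 - a) * l <= 2 * ln N]; with [k >= n / ln l] this
   yields [n <= 2 * ln N * mu]. *)
have l_le : l <= ln N%:R.
  by rewrite /l ln_div ?posrE // lerBlDr lerDl ln_ge0 // ler1n.
have lnp : - ln (N%:R * p0) <= ln N%:R.
  have := ln_ge0 Np0; rewrite expr2 -mulrA lnM ?posrE ?mulr_gt0 //; lra.
have ul : (1 - a) * ln l <= 2 * ln N%:R.
  have : (1 - a) * ln l <= (1 - a) * l.
    by apply: ler_wpM2l; rewrite ltW // ln_sublinear.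
  by rewrite al; lra.
have n_le : n%:R <= 2 * ln N%:R * mu.
  apply: (@le_trans _ _ (ln l * k%:R)); first by rewrite mulrC -ler_pdivrMr.
  apply: (@le_trans _ _ (ln l * ((1 - a) * mu))).
    by apply: ler_wpM2l; [exact: ltW | apply: le_trans muk; rewrite ler_peMl; lra].
  by rewrite mulrA [ln l * _]mulrC; apply: ler_wpM2r => //; exact: ltW.
have d2mu : 0 < d ^+ 2 * mu by apply: mulr_gt0 => //; apply: exprn_gt0.
rewrite -[leLHS]mul1r ler_pdivrMr //.
have -> : 2 * ln N%:R / (d ^+ 2 * n%:R) * (d ^+ 2 * mu) = 2 * ln N%:R * mu / n%:R.
  by field; rewrite !lt0r_neq0.
by rewrite ler_pdivlMr // mul1r.
Qed.

Lemma limn_einf_gt (R : realType) (v : nat -> R) :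
  (1 < limn_einf (fun N => (v N)%:E))%E ->
  exists2 eps : R, 0 < eps & \forall N \near \oo, 1 + eps <= v N.
Proof.
move=> v1.
have [m vm] : exists m, (1 < einfs (fun N => (v N)%:E) m)%E.
  apply: contrapT => H; move: v1; rewrite ltNge => /negP; apply.
  rewrite limn_einf_lim; apply: lime_le; first exact: is_cvg_einfs.
  by near=> m; rewrite leNgt; apply/negP => h; apply: H; exists m.
have [r] : exists2 r : R, 1 < r & (r%:E <= einfs (fun N => (v N)%:E) m)%E.
  case E : (einfs (fun N => (v N)%:E) m) vm => [r| |] // h.
    by exists r; rewrite -?lte_fin.
  by exists 2; rewrite ?leey //; lra.
move=> r1 rm; exists (r - 1); first by rewrite subr_gt0.
near=> N.
rewrite addrC subrK -lee_fin; apply: le_trans rm _.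
apply: ereal_inf_lbound; exists N => //=.
by near: N; exists m.
Unshelve. all: by end_near. Qed.

Lemma risk_ge0 (R : realType) N n (p0 p1 : R) (phi : 'M[bool]_N -> bool) :
  0 <= p0 <= 1 -> 0 <= risk n p0 p1 phi.
Proof.
move=> p01; apply: addr_ge0; last exact: bigmax_ge_id.
rewrite graph_probE graph_expectE; apply: Ex_ge0 => // y; exact: ler0n.
Qed.

(** Common end of both regimes: the null error vanishes because [N / n] diverges, the other one
    because [n / ln N] does. *)
Lemma powerful_of_signal (R : realType) (n : nat -> nat) (p0 p1 : nat -> R) (eps : R) :
  (forall N, 0 <= p0 N) -> (forall N, p0 N < p1 N) -> (forall N, p1 N <= 1) ->
  (\forall N \near \oo, (0 < n N)%N) ->
  (forall M : R, \forall N \near \oo, M <= ln (N%:R / (n N)%:R)) ->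
  (forall M : R, \forall N \near \oo, M <= (n N)%:R / ln N%:R) ->
  (\forall N \near \oo, 1 <= N%:R ^+ 2 * p0 N) ->
  0 < eps ->
  (\forall N \near \oo, alpha N (n N) (p0 N) < 1) ->
  (\forall N \near \oo, forall S : {set 'I_N}, #|S| = n N -> exists k,
     [/\ (0 < k <= n N)%N, (n N)%:R / loglog_ratio R N (n N) <= k%:R &
      (1 + eps) * k%:R <= (1 - alpha N (n N) (p0 N)) *
         mean_max (planted (p0 N) (p1 N) S) S k]) ->
  asymptotically_powerful n p0 p1 (fun N W => broad_scan R (n N) W).
Proof.
move=> p00 p0p1 p11 n_gt0 l_oo nlog p0e eps0 a1 sig.
exists (fun N => (1 + eps / 2) / (1 - alpha N (n N) (p0 N))).
apply/cvgrPdist_le => e e0.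
pose B := 8 * expR (3 / 2) / eps ^+ 2 : R.
pose d := (eps / 2) / (1 + eps).
have B0 : 0 < B by rewrite divr_gt0 ?exprn_gt0 ?mulr_gt0 ?expR_gt0.
have d0 : 0 < d by rewrite divr_gt0 ?divr_gt0 //; lra.
near=> N.
have h0 : 0 <= p0 N <= 1 by rewrite p00 ltW // (lt_le_trans (p0p1 N)).
rewrite sub0r normrN ger0_norm ?risk_ge0 //.
have nN : (0 < n N)%N by near: N.
have np0 : 1 <= N%:R ^+ 2 * p0 N by near: N.
have l2 : 2 <= ln (N%:R / (n N)%:R) :> R by near: N; apply: l_oo.
have lB : 2 * B <= ln (N%:R / (n N)%:R) :> R by near: N; apply: l_oo.
have lBe : 4 * B / e <= ln (N%:R / (n N)%:R) :> R by near: N; apply: l_oo.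
have nl : 4 / (d ^+ 2 * e) <= (n N)%:R / ln N%:R :> R by near: N; apply: nlog.
have al : alpha N (n N) (p0 N) < 1 by near: N.
have p0pos : 0 < p0 N.
  rewrite lt0r p00 andbT; apply/eqP => p00'; move: np0; rewrite p00' mulr0; lra.
set l := ln (N%:R / (n N)%:R) in l2 lB lBe.
have l0 : 0 < l by lra.
have Bl : B / l <= 1 / 2 by rewrite ler_pdivrMr //; lra.
have ul : 0 < ln l by apply: ln_gt0; lra.
have sN : forall S : {set 'I_N}, #|S| = n N -> exists k,
     [/\ (0 < k <= n N)%N, (n N)%:R / loglog_ratio R N (n N) <= k%:R &
      (1 + eps) * k%:R <= (1 - alpha N (n N) (p0 N)) *
         mean_max (planted (p0 N) (p1 N) S) S k] by near: N.
apply: le_trans (risk_le eps0 p0pos (p0p1 N) (p11 N) nN np0 ul Bl al sN) _.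
rewrite -/l -/B -/d.
have n0 : 0 < (n N)%:R :> R by rewrite ltr0n.
have d20 : 0 < d ^+ 2 by apply: exprn_gt0.
have d2e0 : 0 < 4 / (d ^+ 2 * e) by apply: divr_gt0; [lra | exact: mulr_gt0].
have lnN : 0 < ln N%:R :> R.
  by rewrite -invr_gt0 -(pmulr_rgt0 _ n0); apply: lt_le_trans nl.
have t1 : B / l <= e / 4.
  rewrite ler_pdivrMr // mulrC -ler_pdivrMr //; last by lra.
  by apply: le_trans lBe; rewrite le_eqVlt; apply/orP; left; apply/eqP; field; rewrite lt0r_neq0.
have t2 : 2 * ln N%:R / (d ^+ 2 * (n N)%:R) <= e / 2.
  rewrite ler_pdivrMr; last exact: mulr_gt0.
  rewrite ler_pdivlMr // in nl.
  have : e * d ^+ 2 / 2 * (4 / (d ^+ 2 * e) * ln N%:R) <= e * d ^+ 2 / 2 * (n N)%:R.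
    by apply: ler_wpM2l => //; apply: divr_ge0 => //; apply: mulr_ge0; exact: ltW.
  have -> : e * d ^+ 2 / 2 * (4 / (d ^+ 2 * e) * ln N%:R) = 2 * ln N%:R.
    by field; rewrite !lt0r_neq0.
  by move=> h; lra.
lra.
Unshelve. all: by end_near. Qed.

Theorem theorem1 (R : realType) (n : nat -> nat) (p0 p1 : nat -> R)
  (p0_ge0 : forall N, 0 <= p0 N)
  (p0_lt_p1 : forall N, p0 N < p1 N)
  (p1_le1 : forall N, p1 N <= 1)
  (n_oo : (fun N => (n N)%:R : R) @ \oo --> +oo)
  (n_small : (fun N => (n N)%:R / N%:R : R) @ \oo --> (0 : R))
  (n_log : (fun N => (n N)%:R / ln N%:R : R) @ \oo --> +oo)
  (p0_edges : (fun N => N%:R ^+ 2 * p0 N) @ \oo --> +oo)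
  (p1_edges : (fun N => (n N)%:R ^+ 2 * p1 N) @ \oo --> +oo)
  (signal :
    [/\ (limn_esup (fun N => (alpha N (n N) (p0 N))%:E) <= 1)%E
      & exists S : forall N, {set 'I_N},
          (\forall N \near \oo, #|S N| = n N) /\
          (1 < limn_einf (fun N => ((1 - alpha N (n N) (p0 N)) *
                 planted_scan (p0 N) (p1 N) (S N))%:E))%E ]
    \/
    [/\ (fun N => alpha N (n N) (p0 N)) @ \oo --> (0 : R)
      & (1 < limn_einf (fun N => ((n N)%:R * p1 N)%:E))%E ]) :
  asymptotically_powerful n p0 p1 (fun N W => broad_scan R (n N) W).
Proof.
have n_gt0 : \forall N \near \oo, (0 < n N)%N.
  by apply: filterS ((cvgryPge _).1 n_oo 1) => N h; rewrite -(ltr_nat R); lra.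
have l_oo (M : R) : \forall N \near \oo, M <= ln (N%:R / (n N)%:R).
  near=> N.
  have N0 : (0 < N)%N by near: N; exists 1%N.
  have nN : (0 < n N)%N by near: N.
  have nNM : (n N)%:R / N%:R < expR (- M).
    by near: N; apply: (cvgr_lt 0) => //; apply: expR_gt0.
  rewrite -[leLHS]expRK ler_ln ?posrE ?expR_gt0 ?divr_gt0 ?ltr0n //.
  rewrite -[leRHS]invrK invf_div -[leLHS]invrK -expRN.
  by rewrite lef_pV2 ?posrE ?expR_gt0 ?divr_gt0 ?ltr0n // ltW.
have nlog (M : R) : \forall N \near \oo, M <= (n N)%:R / ln N%:R.
  exact: ((cvgryPge _).1 n_log M).
have p0e : \forall N \near \oo, 1 <= N%:R ^+ 2 * p0 N.
  exact: ((cvgryPge _).1 p0_edges 1).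
have p01 N : 0 <= p0 N <= 1 by rewrite p0_ge0 ltW // (lt_le_trans (p0_lt_p1 N)).
have p11 N : 0 <= p1 N <= 1 by rewrite p1_le1 andbT (le_trans (p0_ge0 N)) // ltW.
case: signal => [[_ [S [cS /limn_einf_gt[eps eps0 sig]]]]|[a0 /limn_einf_gt[eps eps0 sig]]].
  have sc_ge0 N : 0 <= planted_scan (p0 N) (p1 N) (S N) by apply: bigmax_ge_id.
  (* The scan is nonnegative, so a product of at least [1 + eps] makes both factors positive. *)
  have big : \forall N \near \oo, alpha N (n N) (p0 N) < 1 /\
      0 < planted_scan (p0 N) (p1 N) (S N).
    apply: filterS sig => N h.
    have sc0 : 0 < planted_scan (p0 N) (p1 N) (S N).
      by rewrite lt0r sc_ge0 andbT; apply/eqP => z; move: h; rewrite z mulr0; lra.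
    split => //; rewrite -subr_gt0 -(pmulr_lgt0 _ sc0); lra.
  apply: (powerful_of_signal p0_ge0 p0_lt_p1 p1_le1 n_gt0 l_oo nlog p0e eps0).
    by apply: filterS big => N [].
  near=> N => T TN.
  have [a1 sc0] : alpha N (n N) (p0 N) < 1 /\ 0 < planted_scan (p0 N) (p1 N) (S N).
    by near: N.
  have sN : 1 + eps <= (1 - alpha N (n N) (p0 N)) * planted_scan (p0 N) (p1 N) (S N).
    by near: N.
  have SN : #|S N| = n N by near: N.
  have nN : (0 < n N)%N by near: N.
  have l2 : 2 <= ln (N%:R / (n N)%:R) :> R by near: N; apply: l_oo.
  have u0 : 0 < loglog_ratio R N (n N) by apply: ln_gt0; lra.
  have [k [kn nk]] := scan_sup_ge sc0 (lexx _); rewrite SN in kn nk.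
  have k0 : 0 < k%:R :> R by apply: lt_le_trans nk; rewrite divr_gt0 // ltr0n.
  rewrite mean_maxE ler_pdivlMr // => sck.
  exists k; split => //; first by rewrite kn andbT -(ltr_nat R).
  apply: (@le_trans _ _ ((1 - alpha N (n N) (p0 N)) *
      (planted_scan (p0 N) (p1 N) (S N) * k%:R))).
    by rewrite mulrA; apply: ler_wpM2r => //; exact: ltW.
  apply: ler_wpM2l; first by rewrite subr_ge0 ltW.
  by apply: le_trans sck _; apply: mean_max_le_card; rewrite // SN.
have g0 : 0 < eps / 3 by lra.
have [e [delta [n0 [e0 delta0 giant]]]] := giant_density g0.
have e2 : 0 < e / 2 by lra.
(* This leaves [(1 - alpha) * (1 + e) >= 1 + e / 2]. *)
have a_small : \forall N \near \oo, alpha N (n N) (p0 N) < (e / 2) / (1 + e).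
  by apply: (cvgr_lt 0) => //; apply: divr_gt0; lra.
apply: (powerful_of_signal p0_ge0 p0_lt_p1 p1_le1 n_gt0 l_oo nlog p0e e2).
  apply: filterS a_small => N /lt_trans; apply.
  by rewrite ltr_pdivrMr; lra.
near=> N => T TN.
have aN : alpha N (n N) (p0 N) < (e / 2) / (1 + e) by near: N.
have nN : (0 < n N)%N by near: N.
have n0N : n0 <= (n N)%:R by near: N; exact: ((cvgryPge _).1 n_oo n0).
(* Then [u_N >= delta^-1], which puts every [k >= delta * n] above the lower end [n / u_N] of the
   scan. *)
have lN : expR (delta^-1) <= ln (N%:R / (n N)%:R) by near: N; apply: l_oo.
have sN : 1 + eps <= (n N)%:R * p1 N by near: N.
have [k [kT kd km]] : exists k, [/\ (0 < k <= #|T|)%N, delta * #|T|%:R <= k%:R &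
    (1 + e) * k%:R <= mean_max (planted (p0 N) (p1 N) T) T k].
  by apply: giant => //; rewrite TN //; lra.
rewrite TN in kT kd; exists k; split => //.
  have uN : delta^-1 <= loglog_ratio R N (n N).
    rewrite -[leLHS]expRK ler_ln ?posrE ?expR_gt0 //.
    by apply: lt_le_trans lN; exact: expR_gt0.
  have u0 : 0 < loglog_ratio R N (n N) by apply: lt_le_trans uN; rewrite invr_gt0.
  apply: le_trans kd; rewrite ler_pdivrMr // mulrAC -[leLHS]mul1r.
  apply: ler_wpM2r; first exact: ler0n.
  by rewrite -ler_pdivrMl // mulr1.
rewrite ltr_pdivlMr in aN; last by lra.
apply: le_trans (ler_wpM2l _ km); last by nra.
by rewrite mulrA; apply: ler_wpM2r; [exact: ler0n | lra].
Unshelve. all: by end_near. Qed.
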